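(* Let $G = \langle A * B;\ H\rangle$ be the generalized free product of groups $A$ and $B$ with amalgamated subgroup $H$, and let $\mathfrak{P}$ be a set of primes. Suppose that $G$ and $\mathfrak{P}$ satisfy Condition $( * )$ and at least one of the following additional conditions holds: $(\alpha)$ $H$ is locally cyclic; $(\beta)$ $H$ lies in the center of $A$ or in the center of $B$; $(\gamma)$ $H$ is a retract of $A$ or of $B$. Then the following statements hold. 1. If $H$ is $\mathcal{F}_{q}$-separable in $A$ and in $B$ for some $q \in \mathfrak{P}$, then $G$ is residually an $\mathcal{FN}_{\mathfrak{P}}$-group. 2. If $H$ is $\mathcal{FN}_{\mathfrak{P}}$-separable in $A$ and in $B$, then $G$ is residually a $\Phi\cdot\mathcal{FN}_{\mathfrak{P}}$-group and, for each prime $p$, residually an $\mathcal{F}_{p}\cdot\mathcal{FN}_{\mathfrak{P}}$-group. In particular, $G$ is residually a finite metanilpotent $\mathfrak{P}$-group.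
   Context: $G=\langle A*B;\ H\rangle$ means that $G$ is the generalized (amalgamated) free product of $A$ and $B$ with amalgamated subgroup $H$; $A$ and $B$ are regarded as subgroups of $G$, with $A\cap B=H$. For a set of primes $\mathfrak{P}$, a $\mathfrak{P}$-number is an integer all of whose prime divisors lie in $\mathfrak{P}$, and a $\mathfrak{P}$-group is a periodic group all of whose element orders are $\mathfrak{P}$-numbers. $\Phi$, $\mathcal{F}_{\mathfrak{P}}$, $\mathcal{FN}_{\mathfrak{P}}$ are the classes of free groups, finite $\mathfrak{P}$-groups and finite nilpotent $\mathfrak{P}$-groups; $\mathcal{F}_p$ is the class of finite $p$-groups ($p$ prime). For classes $\mathcal{C},\mathcal{D}$, $\mathcal{C}\cdot\mathcal{D}$ is the class of all extensions of a $\mathcal{C}$-group by a $\mathcal{D}$-group (groups having a normal subgroup in $\mathcal{C}$ with quotient in $\mathcal{D}$). A group is metanilpotent if it is an extension of a nilpotent group by a nilpotent group. A group $X$ is residually a $\mathcal{C}$-group if for every $x\in X\setminus\{1\}$ there is a homomorphism $\sigma$ of $X$ onto a group from $\mathcal{C}$ with $x\sigma\neq1$. A subgroup $Y\leqslant X$ is $\mathcal{C}$-separable in $X$ if for every $x\in X\setminus Y$ there is a homomorphism $\sigma$ of $X$ onto a group from $\mathcal{C}$ with $x\sigma\notin Y\sigma$. An abelian group is $\mathfrak{P}$-bounded if in each of its quotient groups, for every $p\in\mathfrak{P}$, the $p$-primary component of the periodic part is finite. A nilpotent group is $\mathfrak{P}$-bounded if it has a finite central series with $\mathfrak{P}$-bounded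 abelian factors; $\mathcal{BN}_{\mathfrak{P}}$ is the class of $\mathfrak{P}$-bounded nilpotent groups. $G=\langle A*B;\ H\rangle$ and $\mathfrak{P}$ satisfy Condition $( * )$ if: (i) $A\neq H\neq B$; (ii) $\mathfrak{P}$ is non-empty; (iii) $A$ and $B$ are residually $\mathcal{FN}_{\mathfrak{P}}$-groups; (iv) there exist homomorphisms of $A$ and of $B$ mapping them onto $\mathcal{BN}_{\mathfrak{P}}$-groups and acting injectively on $H$. $H$ is a retract of a group $X\geqslant H$ if there is a normal subgroup $S$ of $X$ with $S\cap H=1$ and $X=SH$. *)

(* Defs.v *)
(* Groups, not necessarily finite, are [groupType]s of MathComp's monoid.v;
   subsets are the classical sets of MathComp-Analysis.  Subgroups are
   predicates on a group, or images of injective homomorphisms. *)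
From HB Require Import structures.
From mathcomp Require Import all_boot.
From mathcomp Require Import boolp classical_sets functions cardinality.

Set Implicit Arguments.
Unset Strict Implicit.
Unset Printing Implicit Defensive.

Local Open Scope classical_set_scope.
Local Open Scope group_scope.

Notation hom X Y := (UMagmaMorphism.type X Y).

Definition surjective (X Y : Type) (f : X -> Y) : Prop := range f = [set: Y].

Definition kernel (X Y : groupType) (f : hom X Y) : set X := [set x | f x = 1].

Definition subgroup (X : groupType) (K : set X) : Prop :=
  K 1 /\ forall x y, K x -> K y -> K (x / y).

Definition normal (X : groupType) (K : set X) : Prop :=
  subgroup K /\ forall x y, K x -> K (x ^ y).

Definition generated (X : groupType) (S : set X) : set X :=
  smallest (@subgroup X) S.

Definition center (X : groupType) : set X :=
  [set x | forall y : X, commute x y].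
Arguments center X : clear implicits.

Definition abelian_group (X : groupType) : Prop := forall x y : X, commute x y.

Definition locally_cyclic (X : groupType) : Prop :=
  forall S : set X, finite_set S -> exists c : X, generated S = generated [set c].

Definition retract (X : groupType) (Y : set X) : Prop :=
  exists S : set X, [/\ normal S, S `&` Y = [set 1] &
    forall x, exists s y, [/\ S s, Y y & x = s * y]].

(* [class_in_section C K M]: the factor group K / M of a subgroup K of X is in
   C.  The values outside K of the map f of K onto K / M are irrelevant. *)
Definition class_in_section (C : groupType -> Prop) (X : groupType)
    (K M : set X) : Prop :=
  exists (Q : groupType) (f : X -> Q),
    [/\ C Q, (forall x y, K x -> K y -> f (x * y) = f x * f y),
        f @` K = [set: Q] & K `&` [set x | f x = 1] = M].

Definition central_series (X : groupType) (n : nat) (Z : nat -> set X) : Prop :=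
  [/\ Z 0 = [set 1], Z n = [set: X],
      (forall i, (i <= n)%N -> normal (Z i)),
      (forall i, (i < n)%N -> Z i `<=` Z i.+1) &
      (forall i, (i < n)%N -> forall x y, Z i.+1 x -> Z i [~ x, y])].

Definition nilpotent_group (X : groupType) : Prop :=
  exists n (Z : nat -> set X), central_series n Z.

Definition finite_group (X : groupType) : Prop := finite_set [set: X].

Definition has_order (X : groupType) (x : X) (n : nat) : Prop :=
  [/\ (0 < n)%N, x ^+ n = 1 & forall m, (0 < m)%N -> x ^+ m = 1 -> (n <= m)%N].

Section Classes.
Variable P : nat_pred.

(* Every element has an order, that is, the group is periodic, and this order
   is a P-number. *)
Definition P_group (X : groupType) : Prop :=
  forall x : X, exists2 n, has_order x n & P.-nat n.

Definition finite_P_group (X : groupType) : Prop := finite_group X /\ P_group X.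

Definition finite_nilpotent_P_group (X : groupType) : Prop :=
  finite_P_group X /\ nilpotent_group X.

Definition primary_component (X : groupType) (p : nat) : set X :=
  [set x | exists k, x ^+ (p ^ k)%N = 1].
Arguments primary_component X p : clear implicits.

Definition bounded_abelian_group (X : groupType) : Prop :=
  abelian_group X /\
  forall (Q : groupType) (f : hom X Q), surjective f ->
    forall p, p \in P -> finite_set (primary_component Q p).

Definition bounded_nilpotent_group (X : groupType) : Prop :=
  exists n (Z : nat -> set X), central_series n Z /\
    forall i, (i < n)%N ->
      class_in_section bounded_abelian_group (Z i.+1) (Z i).

End Classes.

Definition free_group (F : groupType) : Prop :=
  exists (I : Type) (e : I -> F), forall (K : groupType) (f : I -> K),
    exists g : hom F K, (forall i, g (e i) = f i) /\
      forall g' : hom F K, (forall i, g' (e i) = f i) -> g' =1 g.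

(* The classes C below are closed under isomorphism, so the normal subgroup
   and its quotient are given up to isomorphism by a short exact sequence. *)
Definition extension_class (C D : groupType -> Prop) (X : groupType) : Prop :=
  exists (N Q : groupType) (f : hom N X) (g : hom X Q),
    [/\ C N, D Q, injective f, surjective g & range f = kernel g].

Definition metanilpotent_group : groupType -> Prop :=
  extension_class nilpotent_group nilpotent_group.

Definition finite_metanilpotent_P_group (P : nat_pred) (X : groupType) : Prop :=
  finite_P_group P X /\ metanilpotent_group X.

Definition residually (C : groupType -> Prop) (X : groupType) : Prop :=
  forall x : X, x <> 1 ->
    exists (Y : groupType) (s : hom X Y), [/\ C Y, surjective s & s x <> 1].

Definition separable (C : groupType -> Prop) (X : groupType) (Y : set X) : Prop :=
  forall x : X, ~ Y x ->
    exists (Z : groupType) (s : hom X Z),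
      [/\ C Z, surjective s & ~ (s @` Y) (s x)].

(* G is the generalized free product <A * B; H>, where the common subgroup H
   is embedded in A by i and in B by j, and G receives A by a and B by b.
   The maps a and b are necessarily injective, and a(A), b(B) meet exactly in
   the image of H (Schreier). *)
Definition generalized_free_product (A B H G : groupType)
    (i : hom H A) (j : hom H B) (a : hom A G) (b : hom B G) : Prop :=
  [/\ injective i, injective j, (forall h, a (i h) = b (j h)) &
      forall (K : groupType) (f : hom A K) (g : hom B K),
        (forall h, f (i h) = g (j h)) ->
        exists u : hom G K,
          ((forall x, u (a x) = f x) /\ (forall y, u (b y) = g y)) /\
          forall u' : hom G K,
            (forall x, u' (a x) = f x) -> (forall y, u' (b y) = g y) ->
            u' =1 u].

Definition maps_to_bounded_injectively_on (P : nat_pred) (X : groupType)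
    (Y : set X) : Prop :=
  exists (Q : groupType) (s : hom X Q),
    [/\ bounded_nilpotent_group P Q, surjective s &
        forall x y, Y x -> Y y -> s x = s y -> x = y].

Definition condition_star (P : nat_pred) (A B H : groupType)
    (i : hom H A) (j : hom H B) : Prop :=
  [/\ range i <> [set: A] /\ range j <> [set: B],
      exists p, p \in P,
      residually (finite_nilpotent_P_group P) A /\
      residually (finite_nilpotent_P_group P) B &
      maps_to_bounded_injectively_on P (range i) /\
      maps_to_bounded_injectively_on P (range j)].

(* Main.v *)
(* Work with pairs of homomorphisms of A and B to a finite group that agree on H.

   A bounded nilpotent group induces on each of its subgroups the full pro-p
   topology for p in P: a normal subgroup maximal for missing the elements of H
   outside U has a quotient whose center is a finite p-group, which is then a
   finite p-group itself.  Hence kernels of finite p-quotients of A and B can be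
   made to agree on H, and a compatible pair of chief series, which exists in each
   of the cases (alpha), (beta), (gamma), lifts step by step to a homomorphism of
   G to a finite p-group (Higman's argument, here by explicit wreath products).

   Let psi : G -> Q be such that no syllable of a reduced word falls into psi(H),
   and let r : Q -> K be constant on the cosets of psi(H).  Conjugating the copy of
   B in K wr Q by r gives a homomorphism G -> K wr Q, under which the base
   component of the word is the alternating product of the values of r along the
   path of the word.  For a suitable finite p-group K this is not 1.  The quotient
   of G by the intersection of all these kernels is an extension of a free group,
   the fundamental group of the graph with edges Q / psi(H), by psi(G). *)

From HB Require Import structures.
From mathcomp Require Import all_boot all_fingroup all_solvable generic_quotient zmodp.
From mathcomp Require Import boolp classical_sets functions cardinality.
Require Import Defs.

Set Implicit Arguments.
Unset Strict Implicit.
Unset Printing Implicit Defensive.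

Local Open Scope classical_set_scope.
Local Open Scope group_scope.

(* The quotient notation of fingroup hides the division of groups. *)
Local Notation "x / y" := (x * y^-1) : group_scope.

(** * Quotients and finite groups *)

(** Lifting central steps matches A and B over H for one prime at a time. When several primes occur,
    a finite nilpotent quotient of A is therefore cut into its p-quotients; each is completed to a
    compatible pair with a bound on the kernel in A alone, and the finitely many pairs are
    multiplied. The product is still nilpotent, but it only keeps the letters of a word outside the
    image of H, and the word itself may die in it. The additional layer K repairs this, and its
    prime is unrelated to those of Q: K can be taken to be a p-group for any p, inside P or not. If
    Q and K are q-groups for the same q, then so is K wr Q, which yields the first statement;
    otherwise base and top of K wr Q yield an extension of a p-group by a nilpotent group, which
    yields the second. *)

Section HomOfMorph.
Variables (X Y : groupType) (f : X -> Y) (fM : {morph f : x y / x * y}).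

Let f1 : f 1 = 1.
Proof. by apply: (mulgI (f 1)); rewrite -fM !mulg1. Qed.

Definition hom_of_morph : hom X Y :=
  HB.pack f (isUMagmaMorphism.Build X Y f (f1, fM)).

End HomOfMorph.

Lemma trivial_hom (X Y : groupType) : {morph (fun=> 1 : Y) : x y / (x : X) * y >-> x * y}.
Proof. by move=> x y; rewrite mulg1. Qed.

Section SubgroupSets.
Variable X : groupType.
Implicit Types K V : set X.

Lemma subgroup1 K : subgroup K -> K 1. Proof. by case. Qed.
Lemma subgroupV K x : subgroup K -> K x -> K x^-1.
Proof. by case=> K1 Kd Kx; rewrite -div1g; apply: Kd. Qed.
Lemma subgroupM K x y : subgroup K -> K x -> K y -> K (x * y).
Proof.
by move=> sK Kx Ky; rewrite -[y]invgK; apply: sK.2 => //; apply: subgroupV.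
Qed.
Lemma subgroupX K x n : subgroup K -> K x -> K (x ^+ n).
Proof.
move=> sK Kx; elim: n => [|n IH]; first exact: subgroup1.
by rewrite expgS; apply: subgroupM.
Qed.
Lemma subgroupMl K x y : subgroup K -> K x -> K (x * y) -> K y.
Proof.
by move=> sK Kx Kxy; rewrite -(mulKg x y); apply: subgroupM => //; apply: subgroupV.
Qed.
Lemma normalJ V x y : normal V -> V x -> V (x ^ y).
Proof. by case=> _; apply. Qed.
Lemma normal_conj V x y : normal V -> V (x ^ y) -> V x.
Proof. by move=> nV /(normalJ y^-1 nV); rewrite conjgK. Qed.
End SubgroupSets.

Lemma subgroup_image (X Y : groupType) (f : hom X Y) (S : set X) :
  subgroup S -> subgroup (f @` S).
Proof.
move=> sS; split; first by exists 1; [apply: subgroup1 | rewrite gmulf1].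
by move=> _ _ [x Sx <-] [y Sy <-]; exists (x / y); [apply: sS.2 | rewrite gmulfF].
Qed.

Section Quotient.
Local Open Scope quotient_scope.
Variables (X : groupType) (V : set X).
Hypothesis nV : normal V.

Let e (x y : X) := `[< V (x / y) >].
Let e_equiv : equivalence_rel e.
Proof.
have sV := nV.1.
have er x : e x x by apply/asboolP; rewrite mulgV; apply: subgroup1.
have es x y : e x y -> e y x.
  by move=> /asboolP /(subgroupV sV); rewrite invgF => ?; apply/asboolP.
have et x y z : e x y -> e y z -> e x z.
  move=> /asboolP xy /asboolP yz; apply/asboolP.
  by rewrite -(divgKA y x z^-1); apply: subgroupM.
move=> x y z; split=> // exy; apply/idP/idP; last exact: et.
by apply: et; apply: es.
Qed.
Let e_refl : reflexive e. Proof. by move=> x; case: (e_equiv x x x). Qed.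
Let e_sym : symmetric e.
Proof.
by move=> x y; apply/idP/idP=> exy; [have := (e_equiv x y x).2 exy
  | have := (e_equiv y x y).2 exy]; rewrite e_refl => /esym.
Qed.
Let e_trans : transitive e.
Proof. by move=> y x z exy eyz; rewrite ((e_equiv x y z).2 exy). Qed.
Let eqv := EquivRel e e_refl e_sym e_trans.

Definition quotient_by : Type := {eq_quot eqv}.
HB.instance Definition _ := Choice.on quotient_by.
Definition quot_pi (x : X) : quotient_by := \pi_({eq_quot eqv}) x.

Lemma quot_pi_eq x y : quot_pi x = quot_pi y <-> V (x / y).
Proof.
by split=> [/eqmodP/asboolP|/asboolP xy]; last exact/eqmodP.
Qed.

Let r (q : quotient_by) : X := repr q.
Let rK q : quot_pi (r q) = q. Proof. exact: reprK. Qed.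
Let qmul a b := quot_pi (r a * r b).
Let qmulE x y : qmul (quot_pi x) (quot_pi y) = quot_pi (x * y).
Proof.
apply/quot_pi_eq.
have /quot_pi_eq Vx : quot_pi (r (quot_pi x)) = quot_pi x by rewrite rK.
have /quot_pi_eq Vy : quot_pi (r (quot_pi y)) = quot_pi y by rewrite rK.
set x' := r _ in Vx *; set y' := r _ in Vy *.
have -> : (x' * y') / (x * y) = (y' / y) ^ x'^-1 * (x' / x).
  by rewrite conjgE !gnorm.
by apply: subgroupM nV.1 (normalJ _ nV Vy) Vx.
Qed.
Let qinv a := quot_pi (r a)^-1.
Let qmulA : associative qmul.
Proof.
by move=> a b c; rewrite -(rK a) -(rK b) -(rK c) !qmulE mulgA.
Qed.
Let qmul1 : left_id (quot_pi 1) qmul.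
Proof. by move=> a; rewrite -(rK a) qmulE mul1g. Qed.
Let qmulr1 : right_id (quot_pi 1) qmul.
Proof. by move=> a; rewrite -(rK a) qmulE mulg1. Qed.
Let qmulV : left_inverse (quot_pi 1) qinv qmul.
Proof. by move=> a; rewrite -{2}(rK a) qmulE mulVg. Qed.
Let qmulrV : right_inverse (quot_pi 1) qinv qmul.
Proof. by move=> a; rewrite -{1}(rK a) qmulE mulgV. Qed.
HB.instance Definition _ := isGroup.Build quotient_by
  qmulA qmul1 qmulr1 qmulV qmulrV.

Lemma exists_quotient_hom :
  exists (Y : groupType) (f : hom X Y), surjective f /\ forall x, f x = 1 <-> V x.
Proof.
have fM : {morph quot_pi : x y / x * y} by move=> x y; rewrite -qmulE.
exists quotient_by, (hom_of_morph fM); split.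
  by apply/seteqP; split=> // q _; exists (r q) => //; apply: rK.
move=> x; have := quot_pi_eq x 1; rewrite divg1 => <-.
by rewrite -[in X in X <-> _](gmulf1 : hom_of_morph fM 1 = 1).
Qed.
End Quotient.

Section SubgroupType.
Variables (X : groupType) (K : set X).
Hypothesis sK : subgroup K.

Let inK : pred X := fun x => `[< K x >].
Let inK_closed : group_closed inK.
Proof.
split; first by apply/asboolP; apply: subgroup1.
by move=> x y /asboolP Kx /asboolP Ky; apply/asboolP; apply: sK.2.
Qed.

Definition subgroup_type : Type := {x : X | inK x}.
HB.instance Definition _ := SubChoice.on subgroup_type.
HB.instance Definition _ :=
  SubChoice_isSubGroup.Build X inK subgroup_type inK_closed.

Lemma exists_subgroup_hom :
  exists (Y : groupType) (f : hom Y X), injective f /\ range f = K.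
Proof.
have fM : {morph (fun y : subgroup_type => val y) : x y / x * y} by [].
exists subgroup_type, (hom_of_morph fM); split; first exact: val_inj.
apply/seteqP; split=> [_ [y _ <-]|x Kx]; first exact/asboolP/(valP y).
by exists (Sub x (asboolT Kx)) => //=; rewrite SubK.
Qed.
End SubgroupType.

Section FiniteGroups.

Lemma finite_finGroup (Y : groupType) : finite_group Y ->
  exists (Q : finGroupType) (f : hom Y Q), bijective f.
Proof.
move=> /finite_seqP[s sE].
have s_axiom : Finite.axiom (undup s).
  move=> x; rewrite count_uniq_mem ?undup_uniq // mem_undup.
  by have : [set: Y] x by []; rewrite sE /= => ->.
have s_index : pcancel (fun x : Y => index x s) (fun n => onth s n).
  move=> x; have : [set: Y] x by []. 
  rewrite sE /= => xs; by rewrite onthE (nth_map x) ?index_mem // nth_index.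
pose Q : finGroupType := HB.pack (Y : Type) (Group.class Y)
  (isCountable.Build Y s_index) (isFinite.Build Y s_axiom).
have idM : {morph (id : Y -> Q) : x y / x * y} by [].
by exists Q, (hom_of_morph idM); exists id.
Qed.

Lemma finGroup_finite (Q : finGroupType) : finite_group Q.
Proof. exact: finite_finset. Qed.

Lemma has_order_inj (X : groupType) (x : X) m n :
  has_order x m -> has_order x n -> m = n.
Proof.
move=> [m0 xm mle] [n0 xn nle]; apply/eqP.
by rewrite eqn_leq mle // nle.
Qed.

Lemma has_order_fin (Q : finGroupType) (x : Q) : has_order x #[x].
Proof.
split; [exact: order_gt0 | exact: expg_order |].
by move=> m m0 xm; apply: dvdn_leq => //; rewrite order_dvdn xm.
Qed.

Lemma P_group_card (P : nat_pred) (Q : finGroupType) :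
  P_group P Q <-> P.-nat #|Q|.
Proof.
split=> [PQ|PQ x].
  apply/andP; split; first by apply/card_gt0P; exists 1.
  apply/allP => p; rewrite mem_primes => /and3P[p_pr _].
  rewrite -cardsT => /(Cauchy p_pr)[x _ xp].
  have [n xn] := PQ x.
  by rewrite (has_order_inj xn (has_order_fin x)) xp pnatE.
exists #[x]; first exact: has_order_fin.
apply: (pnat_dvd _ PQ); rewrite -cardsT; apply: order_dvdG.
exact: finset.in_setT.
Qed.

Lemma p_nat_of_exponent (p : nat) (Q : finGroupType) : prime p ->
  (forall x : Q, exists k, x ^+ (p ^ k) = 1) -> p.-nat #|{: Q}|.
Proof.
move=> p_pr Qp; apply/P_group_card => x; have [k xk] := Qp x.
exists #[x]; first exact: has_order_fin.
apply: (@pnat_dvd _ (p ^ k)); last by rewrite pnatX pnat_id.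
by rewrite order_dvdn xk.
Qed.

Lemma finite_P_groupP (P : nat_pred) (Y : groupType) : finite_P_group P Y ->
  exists (Q : finGroupType) (f : hom Y Q), P.-nat #|Q| /\ bijective f.
Proof.
move=> [/finite_finGroup[Q [f fb]] PY]; exists Q, f; split=> //.
apply/P_group_card => x; case: (fb) => g fK gK.
have [n [n0 xn nmin] Pn] := PY (g x); exists n => //.
split=> //; first by rewrite -(gK x) -gmulfXn xn gmulf1.
move=> m m0 xm; apply: nmin => //; apply: (can_inj fK).
by rewrite gmulfXn gK xm gmulf1.
Qed.

Lemma finite_P_group_fin (P : nat_pred) (Q : finGroupType) :
  P.-nat #|Q| -> finite_P_group P Q.
Proof. by split; [exact: finGroup_finite | exact/P_group_card]. Qed.

Lemma nilpotent_group_fin (Q : finGroupType) :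
  nilpotent [set: Q]%G -> nilpotent_group Q.
Proof.
move=> /ucnP[n Zn]; exists n, (fun i => [set x | x \in 'Z_i([set: Q]%G)]); split.
- by rewrite ucn0; apply/seteqP; split=> x /=; rewrite inE; move/eqP.
- by rewrite Zn; apply/seteqP; split=> x //= _; apply: finset.in_setT.
- move=> i _; split.
    split=> [|x y] /=; first exact: group1.
    by move=> xZ yZ; rewrite groupM ?groupV.
  move=> x y /= xZ; rewrite memJ_norm //.
  by apply: (fintype.subsetP (ucn_norm i [set: Q]%G)); apply: finset.in_setT.
- by move=> i _ x /=; apply: (fintype.subsetP (ucn_subS i [set: Q]%G)).
move=> i _ x y /= xZ.
by apply: (fintype.subsetP (ucn_comm i [set: Q]%G)); apply: mem_commg.
Qed.

End FiniteGroups.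

(** * Finite p-quotients of bounded nilpotent groups *)

Section NilpotentQuotients.
Variable p : nat.

(** The form in which boundedness is used: in every quotient X / V, every subgroup of p-power
    torsion is finite. With V quantified inside, the property passes to quotients by taking
    preimages. *)
Definition p_torsion_finite (X : groupType) : Prop :=
  forall V D : set X, normal V -> subgroup D -> V `<=` D ->
    (forall d, D d -> exists k, V (d ^+ (p ^ k))) ->
  exists s : seq X, forall d, D d -> exists2 t, t \in s & V (t^-1 * d).

(** Formulated by the commutator condition alone, so that images and index shifts of a series are
    series again. *)
Definition nilpotent_length (n : nat) (X : groupType) : Prop :=
  exists Z : nat -> set X, [/\ forall x, Z 0 x -> x = 1, forall x, Z n x &
    forall i x y, Z i.+1 x -> Z i [~ x, y]].

Lemma nilpotent_group_length (X : groupType) :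
  nilpotent_group X -> exists n, nilpotent_length n X.
Proof.
(* Beyond n the series continues with the whole group, because the commutator condition ranges over
   all indices. *)
move=> [n [Z [Z0 Zn _ _ Zc]]]; exists n, (fun i => if (i <= n)%N then Z i else [set: X]).
split=> [x /=||i x y]; first by rewrite Z0.
  by move=> x; rewrite leqnn Zn.
case: ltnP => [lt_in Zx|le_ni _]; first by rewrite ltnW //; apply: Zc.
by case: ifP => // le_in; have -> : i = n; [apply/eqP; rewrite eqn_leq le_in | rewrite Zn].
Qed.

Lemma nilpotent_length_quotient n (X Y : groupType) (f : hom X Y) :
  surjective f -> nilpotent_length n X -> nilpotent_length n Y.
Proof.
move=> fs [Z [Z0 Zn Zc]]; exists (fun i => f @` Z i); split.
- by move=> _ [x /Z0-> <-]; rewrite gmulf1.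
- by move=> y; have [x _ <-] : range f y by [rewrite fs]; exists x.
move=> i _ y [x Zx <-]; have [z _ <-] : range f y by rewrite fs.
by exists [~ x, z]; [apply: Zc | rewrite gmulfR].
Qed.

Lemma p_torsion_finite_quotient (X Y : groupType) (f : hom X Y) :
  surjective f -> p_torsion_finite X -> p_torsion_finite Y.
Proof.
move=> fs Xf V D nV sD VD Dt.
have [||x /VD //|d /= /Dt[k]|s sP] := Xf (f @^-1` V) (f @^-1` D).
- split; first split=> [|x y]; rewrite /preimage /= ?gmulf1; first exact: subgroup1 nV.1.
    by move=> Vx Vy; rewrite gmulfF; apply: nV.1.2.
  by move=> x y Vx; rewrite /preimage /= gmulfJ; apply: normalJ.
- split=> [|x y]; rewrite /preimage /= ?gmulf1; first exact: subgroup1.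
  by move=> Dx Dy; rewrite gmulfF; apply: sD.2.
- by exists k; rewrite /preimage /= gmulfXn.
exists (map f s) => d Dd; have [x _ xd] : range f d by rewrite fs.
have [|t ts] := sP x; first by rewrite /preimage /= xd.
rewrite /preimage /= gmulfM gmulfV xd => Vtd.
by exists (f t) => //; apply: map_f.
Qed.

Lemma expg_coprime1 (X : groupType) (x : X) m n :
  x ^+ m = 1 -> x ^+ n = 1 -> coprime m n -> x = 1.
Proof.
move=> xm xn; case: (posnP m) => [-> /eqP|m0 /eqP cmn].
  by rewrite gcd0n => n1; rewrite n1 expg1 in xn.
have [u v e _] := egcdnP n m0; move: (congr1 (fun k => x ^+ k) e).
by rewrite cmn expgnDr (mulnC u) (mulnC v) !expgM xm xn !expg1n mul1g expg1.
Qed.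

Lemma center_subgroup (X : groupType) : subgroup (center X).
Proof.
split=> [y|x y cx cy z]; first exact/commute_sym/commute1.
by apply/commute_sym/commuteM/commuteV; apply/commute_sym.
Qed.

Lemma center_normal (X : groupType) : normal (center X).
Proof.
split; first exact: center_subgroup.
by move=> x y cx; rewrite conjgE (cx y) mulKg.
Qed.

Lemma center_commg (X : groupType) (x : X) :
  (forall y, [~ x, y] = 1) -> center X x.
Proof. by move=> xy y; apply/commgP/eqP. Qed.

(** If x is central modulo the center, then [x, z] is central and (x^e)^z = x^e [x, z]^e = x^e.
    Hence the center of X / Z(X) is again killed by e, and induction on the length applies. *)
Lemma nilpotent_exponent n (X : groupType) e : nilpotent_length n X ->
    (forall x, center X x -> x ^+ e = 1) -> forall x : X, x ^+ (e ^ n) = 1.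
Proof.
elim: n X => [|n IH] X [Z [Z0 Zn Zc]] Xe x; first by rewrite expg1; apply/Z0/Zn.
have [Y [f [fs fK]]] := exists_quotient_hom (center_normal X).
rewrite expnSr expgM; apply/Xe/fK; rewrite gmulfXn; apply: IH.
  exists (fun i => f @` Z i.+1); split.
  - by move=> _ [z Zz <-]; apply/fK/center_commg => y; apply/Z0/Zc.
  - by move=> y; have [z _ <-] : range f y by [rewrite fs]; exists z.
  move=> i _ y [z Zz <-]; have [u _ <-] : range f y by rewrite fs.
  by exists [~ z, u]; [apply: Zc | rewrite gmulfR].
move=> y; have [{}x _ <-] : range f y by rewrite fs.
move=> cx; rewrite -gmulfXn; apply/fK => z.
have cc : center X [~ x, z].
  by apply/fK; rewrite gmulfR; apply/eqP/commgP/cx.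
have e1 : (x ^+ e) ^ z = x ^+ e.
  rewrite conjXg -(mulVKg x (x ^ z)) -commgEl expgMn; last exact/commute_sym/cc.
  by rewrite (Xe _ cc) mulg1.
by rewrite /commute conjgC e1.
Qed.

Lemma torsion_p_part (X : groupType) (x : X) r : (0 < r)%N -> x ^+ r = 1 ->
  (x ^+ (r`_p)) ^+ (r`_p^') = 1.
Proof. by move=> r0 xr; rewrite -expgM partnC. Qed.

Section Monolith.
Variables (Y : groupType) (H U : set Y).
Hypotheses (p_pr : prime p) (sU : subgroup U).
Hypothesis HU : forall h, H h -> exists k, U (h ^+ (p ^ k)).
Hypothesis maxY : forall N, normal N -> N `&` H `<=` U -> forall x, N x -> x = 1.
Hypothesis Yf : p_torsion_finite Y.

(** The cyclic subgroup generated by c: the pair of natural exponents stands for the integer n -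
    m. *)
Let cyc (c : Y) : set Y := [set x | exists m n, x * c ^+ m = c ^+ n].

Let cyc_normal c : center Y c -> normal (cyc c).
Proof.
move=> cc; have cX x m : commute x (c ^+ m) by apply/commuteX/commute_sym/cc.
split; first split; first by exists 0, 0; rewrite mulg1.
  move=> x y [m [n xE]] [m' [n' yE]]; exists (m + n')%N, (n + m')%N.
  rewrite !expgnDr -xE -mulgA -!(mulgA x) -yE; congr (x * _).
  by rewrite (mulgA (c ^+ m)) -(cX y m) -mulgA mulKg.
move=> x y [m [n xE]]; exists m, n.
have cJ k : (c ^+ k) ^ y = c ^+ k by rewrite conjgE -(cX y k) mulKg.
by rewrite -(cJ m) -(cJ n) -conjMg xE.
Qed.

Let center_U u : center Y u -> U u -> u = 1.
Proof.
move=> cu Uu; apply: (maxY (cyc_normal cu)); last by exists 0, 1%N; rewrite mulg1.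
move=> x [[m [n xE]] _]; rewrite -(mulgK (u ^+ m) x) xE.
by apply: sU.2; apply: subgroupX.
Qed.

(** By [maxY] the normal subgroup [cyc c] contains some h in H outside U. A p-power of h lies in U
    and is central, hence trivial by [center_U]. *)
Let cyc_meets c : center Y c -> c <> 1 -> exists m n k,
  [/\ c ^+ n / c ^+ m <> 1 & (c ^+ n / c ^+ m) ^+ (p ^ k) = 1].
Proof.
move=> cc c1; apply: contrapT => noh; apply: c1.
apply: (maxY (cyc_normal cc)); last by exists 0, 1%N; rewrite mulg1.
move=> h [[m [n hE]] Hh]; have {}hE : h = c ^+ n / c ^+ m by rewrite -hE mulgK.
apply: contrapT => Uh; apply: noh; have [k Uk] := HU Hh; exists m, n, k.
split; rewrite -hE; first by move=> h1; apply: Uh; rewrite h1; apply: subgroup1.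
apply: center_U => //; rewrite hE; have sC := center_subgroup Y.
by apply: (@subgroupX _ (center Y)) => //; apply: sC.2; apply: (@subgroupX _ (center Y)).
Qed.

Let center_torsion c : center Y c -> exists k, c ^+ (p ^ k) = 1.
Proof.
move=> cc; have [->|c1] := EM (c = 1); first by exists 0.
have [r r0 cr] : exists2 r, (0 < r)%N & c ^+ r = 1.
  have [m [n [k [nz hk]]]] := cyc_meets cc c1.
  have : c ^+ (n * p ^ k) = c ^+ (m * p ^ k).
    apply: divg1_eq; rewrite !expgM -expgnFl //.
    by apply: commuteX; apply/commute_sym/cc.
  have pk0 : (0 < p ^ k)%N by rewrite expn_gt0 prime_gt0.
  wlog lt_mn : m n nz hk / (m < n)%N => [W e|e].
    have [lt_mn|lt_nm|eq_mn] := ltngtP m n; first exact: (W m n).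
      apply: (W n m) => // [eq1|]; first by apply: nz; apply: invg_inj; rewrite invgF eq1 invg1.
      by rewrite -invgF expVgn hk invg1.
    by case: nz; rewrite eq_mn mulgV.
  exists ((n - m) * p ^ k)%N; first by rewrite muln_gt0 subn_gt0 lt_mn.
  by rewrite mulnBl expgnFr ?leq_pmul2r // 1?ltnW // e mulgV.
have [d1|d1] := EM (c ^+ (r`_p) = 1); first by move: d1; rewrite p_part; exists (logn p r).
(* d generates the part of [cyc c] of order prime to p. If d were not 1, [cyc d] would contain a
   nontrivial element of p-power order, whose order also divides the p'-part of r. *)
have ds := torsion_p_part r0 cr; set d := c ^+ _ in d1 ds.
have cd : center Y d by apply: (@subgroupX _ (center Y)) => //; apply: center_subgroup.
have [m [n [k [nz hk]]]] := cyc_meets cd d1; case: nz.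
apply: (expg_coprime1 hk (n := (r`_p^')%N)); last first.
  by rewrite coprimeXl // prime_coprime // -p'natE // part_pnat.
rewrite expgnFl; last by apply: commuteX; apply/commute_sym/commuteX.
by rewrite -!expgM !(mulnC _ (r`_p^')%N) !expgM ds !expg1n mulgV.
Qed.

(** [Yf] acts twice. The center is p-torsion, hence finite and of bounded exponent; this exponent
    spreads along the central series to all of Y, which is then p-torsion and finite in turn. *)
Lemma monolith_finite n : nilpotent_length n Y ->
  finite_group Y /\ forall y : Y, exists k, y ^+ (p ^ k) = 1.
Proof.
move=> nilY; have n1 : normal [set (1 : Y)].
  split; first by split=> // x y /= -> ->; rewrite mulgV.
  by move=> x y /= ->; rewrite conj1g.
have [e eP] : exists e, forall c, center Y c -> c ^+ (p ^ e) = 1.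
  have [|d /center_torsion//|s sP] := Yf n1 (center_subgroup Y).
    by move=> _ ->; apply: subgroup1 (center_subgroup Y).
  have {}sP c : center Y c -> c \in s.
    by move=> /sP[t ts /= /mulg1_eq]; rewrite invgK => <-.
  suff [e eP] : exists e, forall c, center Y c -> c \in s -> c ^+ (p ^ e) = 1.
    by exists e => c cc; apply: eP => //; apply: sP.
  elim: s {sP} => [|t s [e eP]]; first by exists 0.
  have [ct|nct] := EM (center Y t); last first.
    by exists e => c cc; rewrite inE => /orP[/eqP ct|/eP->//]; rewrite -ct in nct.
  have [k tk] := center_torsion ct; exists (e + k)%N => c cc; rewrite inE expnD.
  move=> /orP[/eqP->|cs]; first by rewrite mulnC expgM tk expg1n.
  by rewrite expgM eP // expg1n.
have tor := nilpotent_exponent nilY eP.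
have torY (y : Y) : exists k, y ^+ (p ^ k) = 1 by exists (e * n)%N; rewrite expnM.
split=> //.
have [||//|s sP] := Yf n1 (D := [set: Y]); [by [] | by [] | by move=> d _; apply: torY | ].
apply/finite_seqP; exists s; apply/seteqP; split=> // y _.
by have [//|t ts /= /mulg1_eq] := sP y; rewrite invgK => <-.
Qed.

End Monolith.

End NilpotentQuotients.

(** Climb the central series. Modulo the image of V, the image of D in the factor Z(i+1) / Z(i) lies
    in a p-component, finite by boundedness. After division by a representative taken in D and by an
    element of V, what remains lies in D and in Z(i). *)
Lemma bounded_p_torsion_finite (P : nat_pred) p (X : groupType) :
  bounded_nilpotent_group P X -> p \in P -> p_torsion_finite p X.
Proof.
move=> [n [Z [[Z0 Zn nZ Zs Zc] Zb]]] Pp V D nV sD VD Dt.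
suff /(_ n (leqnn n))[s sP] : forall i, (i <= n)%N -> exists s : seq X,
    forall d, D d -> Z i d -> exists2 t, t \in s & V (t^-1 * d).
  by exists s => d Dd; apply: sP => //; rewrite Zn.
elim=> [|i IH] lt_in.
  exists [:: 1] => d _; rewrite Z0 /= => ->; exists 1; first exact: mem_head.
  by rewrite mulVg; apply: subgroup1 nV.1.
have [s sP] := IH (ltnW lt_in).
have [Q [f [[Qab Qb] fM fs fK]]] := Zb i lt_in.
have sZ : subgroup (Z i.+1) by case: (nZ i.+1 lt_in).
have f1 : f 1 = 1.
  by apply: (mulgI (f 1)); rewrite -fM ?mulg1 //; apply: subgroup1.
have fV x : Z i.+1 x -> f x^-1 = (f x)^-1.
  move=> Zx; apply: (mulgI (f x)).
  by rewrite -fM ?mulgV //; apply: subgroupV.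
have fX x k : Z i.+1 x -> f (x ^+ k) = f x ^+ k.
  move=> Zx; elim: k => [|k IHk]; first by [].
  by rewrite !expgS fM ?IHk //; apply: subgroupX.
have nR : normal (f @` (V `&` Z i.+1)).
  split; last by move=> x y; rewrite conjgE (Qab x y) mulKg.
  split; first by exists 1 => //; split; [apply: subgroup1 nV.1 | apply: subgroup1].
  move=> _ _ [v [Vv Zv] <-] [w [Vw Zw] <-]; exists (v / w).
    by split; [apply: nV.1.2 | apply: sZ.2].
  by rewrite fM ?fV //; apply: subgroupV.
have [Y [g [gs gK]]] := exists_quotient_hom nR.
have /finite_seqP[ys ysE] := Qb _ g gs p Pp.
have /choice[c cP] (y : Y) : exists x, forall d, D d -> Z i.+1 d -> g (f d) = y ->
    [/\ D x, Z i.+1 x & g (f x) = y].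
  have [[d [Dd Zd <-]]|nd] := EM (exists d, [/\ D d, Z i.+1 d & g (f d) = y]).
    by exists d.
  by exists 1 => d Dd Zd dy; case: nd; exists d.
exists [seq c y * t | y <- ys, t <- s] => d Dd Zd.
have [Dc Zcd gcE] := cP _ d Dd Zd erefl; set e := c _ in Dc Zcd gcE.
have ys_d : g (f d) \in ys.
  have : @primary_component Y p (g (f d)).
    have [k Vk] := Dt d Dd; exists k; rewrite -gmulfXn -fX //.
    by apply/gK; exists (d ^+ (p ^ k)) => //; split=> //; apply: subgroupX.
  by rewrite ysE.
have [v [Vv Zv] fvE] : (f @` (V `&` Z i.+1)) (f (e^-1 * d)).
  apply/gK; rewrite fM ?fV //; last exact: subgroupV.
  by rewrite gmulfM gmulfV gcE mulVg.
have Zed : Z i.+1 (e^-1 * d) by apply: subgroupM => //; apply: subgroupV.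
have Zz : Z i (v^-1 * (e^-1 * d)).
  have : (Z i.+1 `&` [set x | f x = 1]) (v^-1 * (e^-1 * d)).
    split=> /=; first by apply: subgroupM => //; apply: subgroupV.
    by rewrite fM ?fV // -?fvE ?mulVg //; apply: subgroupV.
  by rewrite fK.
have Dz : D (v^-1 * (e^-1 * d)).
  apply: subgroupM => //; first by apply: subgroupV => //; apply: VD.
  by apply: subgroupM => //; apply: subgroupV.
have [t ts Vt] := sP _ Dz Zz; exists (e * t); first exact: allpairs_f.
have -> : (e * t)^-1 * d = v ^ t * (t^-1 * (v^-1 * (e^-1 * d))).
  by rewrite conjgE !gnorm.
by apply: subgroupM nV.1 _ Vt; apply: normalJ.
Qed.

Lemma finite_p_torsion_finite p (X : groupType) :
  finite_group X -> p_torsion_finite p X.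
Proof.
move=> /finite_seqP[s sE] V D [sV _] _ _ _; exists s => d _; exists d.
  by have : [set: X] d by []; rewrite sE.
by rewrite mulVg; apply: subgroup1.
Qed.

Lemma exists_maximal_normal (X : groupType) (H U : set X) : U 1 ->
  exists V, [/\ normal V, V `&` H `<=` U &
    forall W, normal W -> V `<=` W -> W `&` H `<=` U -> W `<=` V].
Proof.
(* Adjoining 1 makes the union of the empty chain, the empty set, admissible for Zorn's lemma. *)
move=> U1; pose u1 (V : set X) := [set 1] `|` V.
pose ok V := normal (u1 V) /\ u1 V `&` H `<=` U.
have [F okF totF|V [[nV VU] Vmax]] := @Zorn_bigcup X ok.
  split; last first.
    move=> x [[->//|[V FV Vx]] Hx].
    by have [_] := okF V FV; apply; split=> //; right.
  have cup V x : F V -> u1 V x -> u1 (\bigcup_(W in F) W) x.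
    by move=> FV [->|Vx]; [left | right; exists V].
  split; first split; first by left.
    move=> x y [->|[V FV Vx]] [->|[W FW Wy]].
    - by rewrite mulgV; left.
    - by apply: (cup W) => //; apply: (okF W FW).1.1.2; [left | right].
    - by apply: (cup V) => //; apply: (okF V FV).1.1.2; [right | left].
    have [VW|WV] := totF _ _ FV FW.
      by apply: (cup W) => //; apply: (okF W FW).1.1.2; right => //; apply: VW.
    by apply: (cup V) => //; apply: (okF V FV).1.1.2; right => //; apply: WV.
  move=> x y [->|[V FV Vx]]; first by rewrite conj1g; left.
  by apply: (cup V) => //; apply: (okF V FV).1.2; right.
exists (u1 V); split=> // W nW VW WU.
have W1 : u1 W = W by apply/seteqP; split=> x; [case=> // ->; apply: subgroup1 nW.1 | right].
have okW : ok W by rewrite /ok W1.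
move=> w Ww; right; apply: contrapT => nVw; apply: (Vmax W) => //.
by split=> [x Vx|/(_ w Ww)//]; apply: VW; right.
Qed.

Lemma p_quotient_separating p (X : groupType) n (H U : set X) :
  prime p -> nilpotent_length n X -> p_torsion_finite p X ->
  subgroup H -> subgroup U -> U `<=` H -> (forall h, H h -> exists k, U (h ^+ (p ^ k))) ->
  exists (Q : finGroupType) (f : hom X Q),
    [/\ p.-nat #|Q|, surjective f & forall h, H h -> f h = 1 -> U h].
Proof.
move=> p_pr nilX Xf sH sU UH HU.
have [V [nV VU Vmax]] := exists_maximal_normal H (subgroup1 sU).
have [Y [f [fs fK]]] := exists_quotient_hom nV.
have [|||||Yfin tor] := @monolith_finite p Y (f @` H) (f @` U) p_pr _ _ _ _ n.
- exact: subgroup_image.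
- move=> _ [h Hh <-]; have [k Uk] := HU h Hh.
  by exists k, (h ^+ (p ^ k)) => //; rewrite gmulfXn.
- move=> N nN NU y Ny; have [x _ xy] : range f y by rewrite fs.
  rewrite -xy; apply/fK; apply: (Vmax (f @^-1` N)); last by rewrite /preimage /= xy.
  + split; first split=> [|x1 x2]; rewrite /preimage /= ?gmulf1; first exact: subgroup1 nN.1.
      by move=> N1 N2; rewrite gmulfF; apply: nN.1.2.
    by move=> x1 x2 N1; rewrite /preimage /= gmulfJ; apply: normalJ.
  + by move=> v /fK; rewrite /preimage /= => ->; apply: subgroup1 nN.1.
  move=> h [Nh Hh]; have [u Uu uE] : (f @` U) (f h) by apply: NU; split=> //; exists h.
  have Vuh : V (u^-1 * h) by apply/fK; rewrite gmulfM gmulfV uE mulVg.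
  rewrite -(mulVKg u h); apply: subgroupM => //; apply: VU; split=> //.
  by apply: subgroupM => //; apply: subgroupV => //; apply: UH.
- exact: p_torsion_finite_quotient fs Xf.
- exact: nilpotent_length_quotient fs nilX.
have [Q [g gb]] := finite_finGroup Yfin; have [g' gK g'K] := gb.
exists Q, (g \o f); split.
- apply: p_nat_of_exponent => // x; have [k xk] := tor (g' x).
  by exists k; rewrite -(g'K x) -gmulfXn xk gmulf1.
- apply/seteqP; split=> // x _; have [y _ yx] : range f (g' x) by rewrite fs.
  by exists y => //=; rewrite yx g'K.
move=> h Hh /= gfh; apply: VU; split=> //; apply/fK/(can_inj gK).
by rewrite gfh gmulf1.
Qed.

(** A suitable power w of z has prime order p; the separating lemma is applied to the subgroup
    generated by w, with U trivial. *)
Lemma nilpotent_P_group_residually_p (P : nat_pred) (Y : groupType) (z : Y) :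
    {subset P <= prime} -> finite_nilpotent_P_group P Y -> z <> 1 ->
  exists p (Q : finGroupType) (f : hom Y Q),
    [/\ p \in P, p.-nat #|Q| & f z <> 1].
Proof.
move=> Ppr [[Yfin PY] /nilpotent_group_length[l nilY]] z1.
have [n [n0 zn nmin] Pn] := PY z.
have n1 : (1 < n)%N.
  by rewrite ltn_neqAle n0 andbT; apply/eqP => n1; apply: z1; rewrite -n1 expg1 in zn.
set p := pdiv n; have p_pr : prime p := pdiv_prime n1.
have pn : p %| n := pdiv_dvd n.
have Pp : p \in P by rewrite -(pnatE P p_pr); apply: pnat_dvd Pn.
set w := z ^+ (n %/ p).
have wp : w ^+ p = 1 by rewrite -expgM divnK.
have w1 : w <> 1.
  have np0 : (0 < n %/ p)%N by rewrite divn_gt0 ?prime_gt0 // dvdn_leq.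
  by move=> /(nmin _ np0); rewrite leqNgt ltn_Pdiv ?prime_gt1.
pose H : set Y := [set x | exists k, x = w ^+ k].
have sH : subgroup H.
  split; first by exists 0.
  (* Since w^p = 1, the inverse of w^l' is w^(l' (p - 1)). *)
  move=> _ _ [k ->] [l' ->]; exists (k + l' * p.-1)%N.
  rewrite expgnDr; congr (_ * _); apply: mulg1_eq.
  rewrite -expgnDr -[X in (X + _)%N]muln1 -mulnDr add1n prednK ?prime_gt0 //.
  by rewrite mulnC expgM wp expg1n.
have s1 : subgroup [set (1 : Y)].
  by split=> // x y /= -> ->; rewrite mulgV.
have [||Q [f [pQ _ fH]]] := p_quotient_separating p_pr nilY
  (finite_p_torsion_finite Yfin) sH s1.
- by move=> _ ->; apply: subgroup1.
- by move=> _ [k ->]; exists 1%N => /=; rewrite expn1 -expgM mulnC expgM wp expg1n.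
exists p, Q, f; split=> // fz; apply: w1; apply: fH; first by exists 1%N.
by rewrite gmulfXn fz expg1n.
Qed.

(** * Wreath products and central extensions *)

Section Wreath.
Variables (K : groupType) (Q : finGroupType).

(** K may be infinite: the freeness of a kernel is tested by homomorphisms to arbitrary groups K. *)
Definition wreath : Type := ({ffun Q -> K} * Q)%type.
HB.instance Definition _ := Choice.on wreath.

Definition wreath_mul (u v : wreath) : wreath :=
  ([ffun x => u.1 x * v.1 (x * u.2)], u.2 * v.2).
Definition wreath_one : wreath := ([ffun => 1], 1).
Definition wreath_inv (u : wreath) : wreath :=
  ([ffun x => (u.1 (x * u.2^-1))^-1], u.2^-1).

Fact wreath_mulA : associative wreath_mul.
Proof.
move=> u v w; congr (_, _); last exact: mulgA.
by apply/ffunP=> x; rewrite !ffunE /= !mulgA.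
Qed.
Fact wreath_mul1 : left_id wreath_one wreath_mul.
Proof.
move=> [f q]; congr (_, _); last exact: mul1g.
by apply/ffunP=> x; rewrite !ffunE /= mulg1 mul1g.
Qed.
Fact wreath_mulr1 : right_id wreath_one wreath_mul.
Proof.
move=> [f q]; congr (_, _); last exact: mulg1.
by apply/ffunP=> x; rewrite !ffunE /= mulg1.
Qed.
Fact wreath_mulV : left_inverse wreath_one wreath_inv wreath_mul.
Proof.
move=> [f q]; congr (_, _); last exact: mulVg.
by apply/ffunP=> x; rewrite !ffunE /= mulVg.
Qed.
Fact wreath_mulrV : right_inverse wreath_one wreath_inv wreath_mul.
Proof.
move=> [f q]; congr (_, _); last exact: mulgV.
by apply/ffunP=> x; rewrite !ffunE /= mulgK mulgV.
Qed.
HB.instance Definition _ := isGroup.Build wreath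
  wreath_mulA wreath_mul1 wreath_mulr1 wreath_mulV wreath_mulrV.

Lemma wreath_mulE1 (u v : wreath) x : (u * v).1 x = u.1 x * v.1 (x * u.2).
Proof. by rewrite ffunE. Qed.
Lemma wreath_mulE2 (u v : wreath) : (u * v).2 = u.2 * v.2.
Proof. by []. Qed.
Lemma wreath_oneE1 x : (1 : wreath).1 x = 1.
Proof. by rewrite ffunE. Qed.
Lemma wreath_invE1 (u : wreath) x : (u^-1).1 x = (u.1 (x * u.2^-1))^-1.
Proof. by rewrite ffunE. Qed.
Lemma wreath_invE2 (u : wreath) : (u^-1).2 = u.2^-1.
Proof. by []. Qed.

Lemma wreathP (u v : wreath) : (forall x, u.1 x = v.1 x) -> u.2 = v.2 -> u = v.
Proof. by case: u v => [f q] [g r] /= fg ->; congr (_, _); apply/ffunP. Qed.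

Lemma wreath_hom (X : groupType) (psi : hom X Q) (f : X -> Q -> K) :
    (forall x y q, f (x * y) q = f x q * f y (q * psi x)) ->
  exists phi : hom X wreath, forall x, phi x = ([ffun q => f x q], psi x).
Proof.
move=> fM; have phiM : {morph (fun x => ([ffun q => f x q], psi x) : wreath)
    : x y / x * y}.
  move=> x y; congr (_, _); last exact: gmulfM.
  by apply/ffunP=> q; rewrite !ffunE /= fM.
by exists (hom_of_morph phiM).
Qed.
End Wreath.

HB.instance Definition _ (K Q : finGroupType) :=
  Finite.copy (wreath K Q) ({ffun Q -> K} * Q)%type.

Lemma card_wreath (K Q : finGroupType) : #|{: wreath K Q}| = (#|K| ^ #|Q| * #|Q|)%N.
Proof. by rewrite card_prod card_ffun. Qed.

Lemma coset_repr (Q : groupType) (C : set Q) : subgroup C ->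
  exists rho : Q -> Q, (forall x, C (x^-1 * rho x)) /\
    forall x c, C c -> rho (x * c) = rho x.
Proof.
move=> sC; have /choice[r rP] (S : set Q) : exists y, S !=set0 -> S y.
  by have [[y Sy]|nS] := EM (S !=set0); [exists y | exists 1].
(* The choice is applied to the coset as a set, so it is the same for all elements of the coset. *)
exists (fun x => r [set y | C (x^-1 * y)]); split=> [x|x c Cc].
  by apply: (rP [set y | C (x^-1 * y)]); exists x; rewrite /= mulVg; apply: subgroup1.
congr r; apply/seteqP; split=> y /=; rewrite invgM -mulgA; last first.
  by apply: subgroupM => //; apply: subgroupV.
by apply: subgroupMl => //; apply: subgroupV.
Qed.

Lemma range_subgroup (X Y : groupType) (f : hom X Y) : subgroup (range f).
Proof.
split; first by exists 1; rewrite ?gmulf1.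
by move=> _ _ [x _ <-] [y _ <-]; exists (x / y); rewrite ?gmulfF.
Qed.

Lemma kernel_normal (X Y : groupType) (f : hom X Y) : normal (kernel f).
Proof.
split; first split=> [|x y]; rewrite /kernel /= ?gmulf1 //.
  by move=> fx fy; rewrite gmulfF fx fy mulgV.
by move=> x y; rewrite /kernel /= gmulfJ => ->; rewrite conj1g.
Qed.

(** A Krasner-Kaloujnine embedding with the transversal [tau x = t (rho x) * i (eta x)]. Along H the
    factor [t (rho x)] merely conjugates, and [lam] ignores conjugation, so the cocycle on H is
    expressed by [eta], which A and B share. At the point 1 an element of the kernel of [psi] has
    base component [lam a]. *)
Lemma induced_hom (A H : groupType) (i : hom H A) (Q : finGroupType)
    (E : groupType) (psi : hom A Q) (rho : Q -> Q) (eta : Q -> H) (lam : A -> E) :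
    (forall x, x = rho x * psi (i (eta x))) ->
    (forall x h, rho (x * psi (i h)) = rho x) ->
    (forall k l, kernel psi k -> kernel psi l -> lam (k * l) = lam k * lam l) ->
    (forall k x, kernel psi k -> lam (k ^ x) = lam k) ->
  exists phi : hom A (wreath E Q), [/\ forall a, (phi a).2 = psi a,
    forall h x, (phi (i h)).1 x =
      lam (i (eta x * h / eta (x * psi (i h)))) &
    forall a, phi a = 1 -> psi a = 1 /\ lam a = 1].
Proof.
move=> rhoE rhoM lamM lamJ.
(* [psi] may fail to be surjective: [sg x] is a base point of the coset of psi(A) containing x, and
   [tau x] leads from it to x. *)
have [sg [sgP sgM]] := coset_repr (range_subgroup psi).
have /choice[t tP] x : exists a, x = sg x * psi a.
  have [a _ aE] := sgP x; exists a^-1.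
  by rewrite gmulfV aE invgM invgK mulVKg.
have [tau tauE] : exists tau : Q -> A, forall x, tau x = t (rho x) * i (eta x).
  by exists (fun x => t (rho x) * i (eta x)).
have sg_rho x : sg (rho x) = sg x.
  by rewrite -(sgM (rho x) (psi (i (eta x)))) -?rhoE //; exists (i (eta x)).
have tauP x : x = sg x * psi (tau x).
  by rewrite tauE gmulfM mulgA -sg_rho -tP -rhoE.
have psi_tau x a : psi (tau (x * psi a)) = psi (tau x) * psi a.
  apply: (mulgI (sg x)); rewrite mulgA -tauP -(sgM x (psi a)) -?tauP //.
have kerP x a : kernel psi (tau x * a / tau (x * psi a)).
  by rewrite /kernel /= gmulfF gmulfM psi_tau mulgV.
pose f a x := lam (tau x * a / tau (x * psi a)).
have [|phi phiE] := @wreath_hom E Q A psi f.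
  move=> a b x; rewrite /f -(lamM _ _ (kerP _ _) (kerP _ _)); congr lam; rewrite gmulfM !mulgA.
  by rewrite mulgVK.
have lam1 : lam 1 = 1.
  by apply: (mulgI (lam 1)); rewrite -lamM ?mulg1 // /kernel /= gmulf1.
exists phi; split=> [a|h x|a].
- by rewrite phiE.
- rewrite phiE /= ffunE /f !tauE rhoM.
  set k := eta x * h / _.
  have e : t (rho x) * i (eta x) * i h / (t (rho x) * i (eta (x * psi (i h))))
      = (i k) ^ (t (rho x))^-1.
    by rewrite /k conjgE !gmulfM gmulfV !gnorm.
  rewrite e; apply: lamJ; apply: (normal_conj (y := (t (rho x))^-1) (kernel_normal psi)).
  by rewrite -e; have := kerP x (i h); rewrite !tauE rhoM.
rewrite phiE => -[/ffunP/(_ 1)]; rewrite !ffunE /f => fa pa; split=> //.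
rewrite pa mulg1 in fa; rewrite -fa.
have -> : tau 1 * a / tau 1 = a ^ (tau 1)^-1 by rewrite conjgE invgK mulgA.
by rewrite lamJ.
Qed.

Section Amalgam.
Variables (A B H : groupType) (i : hom H A) (j : hom H B).

(** The kernels are only bounded from above: bounds can be relaxed, and products of pairs intersect
    them. *)
Definition separates (C : finGroupType -> Prop) (N : set A) (M : set B) :=
  exists (Q : finGroupType) (psiA : hom A Q) (psiB : hom B Q),
    [/\ C Q, forall h, psiA (i h) = psiB (j h),
        kernel psiA `<=` N & kernel psiB `<=` M].

Definition separates_p (p : nat) :=
  separates (fun Q : finGroupType => p.-nat #|{: Q}|).

(* The extension of E by the image Q of the amalgam is embedded in a wreath
   product; the two halves of the embedding agree on H because their cocycles
   are computed from one transversal of the image of H in Q. *)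
Lemma separates_p_central (p : nat) (N : set A) (M : set B) (E : finGroupType)
    (lamA : A -> E) (lamB : B -> E) :
    p.-nat #|{: E}| -> separates_p p N M ->
    (forall k l, N k -> N l -> lamA (k * l) = lamA k * lamA l) ->
    (forall k l, M k -> M l -> lamB (k * l) = lamB k * lamB l) ->
    (forall k x, N k -> lamA (k ^ x) = lamA k) ->
    (forall k x, M k -> lamB (k ^ x) = lamB k) ->
    (forall h, N (i h) -> M (j h) -> lamA (i h) = lamB (j h)) ->
  separates_p p [set k | N k /\ lamA k = 1] [set k | M k /\ lamB k = 1].
Proof.
move=> pE [Q [psiA [psiB [pQ psiH kerA kerB]]]] AM BM AJ BJ AB.
have [rho [rhoP rhoM]] := coset_repr (range_subgroup (psiA \o i)).
have /choice[eta etaP] x : exists h, x = rho x * psiA (i h).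
  have [h _ hE] := rhoP x; exists h^-1; rewrite gmulfV gmulfV.
  by have /= -> := hE; rewrite invgM invgK mulVKg.
have rhoMi x h : rho (x * psiA (i h)) = rho x by apply: rhoM; exists h.
have [||phiA [phiA2 phiA1 kphiA]] := induced_hom (lam := lamA) etaP rhoMi.
- by move=> k l /kerA Nk /kerA; apply: AM.
- by move=> k x /kerA; apply: AJ.
have [||||phiB [phiB2 phiB1 kphiB]] := @induced_hom B H j Q E psiB rho eta lamB.
- by move=> x; rewrite -psiH.
- by move=> x h; rewrite -psiH.
- by move=> k l /kerB Nk /kerB; apply: BM.
- by move=> k x /kerB; apply: BJ.
exists (wreath E Q), phiA, phiB; split.
- by rewrite card_wreath pnatM pnatX pE pQ.
- move=> h; apply: wreathP => [x|]; last by rewrite phiA2 phiB2.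
  rewrite phiA1 phiB1 -psiH; set k := _ / _.
  have psik : psiA (i k) = 1.
    rewrite /k !gmulfM !gmulfV; apply: (mulgI (rho x)); rewrite !mulgA -etaP mulg1.
    apply: (mulIg (psiA (i (eta (x * psiA (i h)))))); rewrite mulgVK.
    by rewrite -(rhoMi x h) -etaP.
  by apply: AB; [apply: kerA | apply: kerB; rewrite /kernel /= -psiH].
- by move=> k /kphiA[pk lk]; split=> //; apply: kerA.
by move=> k /kphiB[pk lk]; split=> //; apply: kerB.
Qed.

Lemma separates_sub C (N N' : set A) (M M' : set B) :
  N `<=` N' -> M `<=` M' -> separates C N M -> separates C N' M'.
Proof.
move=> NN MM [Q [psiA [psiB [CQ psiH kA kB]]]]; exists Q, psiA, psiB.
by split=> // x; [move/kA/NN | move/kB/MM].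
Qed.

End Amalgam.

Lemma separates_swap (A B H : groupType) (i : hom H A) (j : hom H B) C N M :
  separates i j C N M -> separates j i C M N.
Proof.
by move=> [Q [psiA [psiB [CQ psiH kA kB]]]]; exists Q, psiB, psiA; split.
Qed.

(** * Compatible chains of normal subgroups *)

Lemma hom_image (X : groupType) (Q : finGroupType) (f : hom X Q) :
  exists (D : {group Q}) (f' : hom X (subg_of D)),
    surjective f' /\ forall x, sgval (f' x) = f x.
Proof.
pose D := [set q : Q | `[< exists x, f x = q >]]%SET.
have gD : group_set D.
  apply/group_setP; split; first by rewrite !inE; exists 1; rewrite gmulf1.
  move=> q1 q2; rewrite !inE => -[x <-] [y <-].
  by exists (x * y); rewrite gmulfM.
have Df x : f x \in Group gD by rewrite !inE; exists x.
have fM : {morph (fun x => subg (Group gD) (f x)) : x y / x * y}.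
  by move=> x y; rewrite gmulfM (subgM (Df x) (Df y)).
have fK x : sgval (subg (Group gD) (f x)) = f x by rewrite subgK.
exists (Group gD), (hom_of_morph fM); split=> //.
apply/seteqP; split=> // q _; have := subgP q; rewrite !inE => -[x xq].
by exists x => //; apply: val_inj; rewrite [LHS]fK.
Qed.

Lemma card_subg_of (Q : finGroupType) (D : {group Q}) : #|subg_of D| = #|D|.
Proof. by rewrite card_sub; apply: eq_card => x; rewrite !inE. Qed.

Lemma hom_image_p (P : nat_pred) (X : groupType) (Q : finGroupType) (f : hom X Q) :
  P.-nat #|{: Q}| -> exists (Q' : finGroupType) (f' : hom X Q'),
    [/\ P.-nat #|{: Q'}|, surjective f' & forall x, f' x = 1 <-> f x = 1].
Proof.
move=> pQ; have [D [f' [fs fE]]] := hom_image f; exists (subg_of D), f'; split=> //.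
  rewrite card_subg_of; apply: pnat_dvd pQ; rewrite -cardsT.
  by apply: cardSg; apply: finset.subsetT.
move=> x; rewrite -fE; split=> [->//|fx]; exact: val_inj.
Qed.

Lemma hom_pair (P : nat_pred) (X : groupType) (Q R : finGroupType)
    (f : hom X Q) (g : hom X R) :
    P.-nat #|{: Q}| -> P.-nat #|{: R}| ->
  exists (T : finGroupType) (h : hom X T), [/\ P.-nat #|{: T}|, surjective h &
    forall x, h x = 1 <-> f x = 1 /\ g x = 1].
Proof.
move=> pQ pR; have fgM : {morph (fun x => (f x, g x) : Q * R) : x y / x * y}.
  by move=> x y; rewrite !gmulfM.
have [|T [h [pT hs hE]]] := hom_image_p (P := P) (hom_of_morph fgM).
  by rewrite card_prod pnatM pQ pR.
exists T, h; split=> // x; rewrite hE; split=> [[-> ->]//|[fx gx]].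
by rewrite /= fx gx.
Qed.

Section CentralChains.
Variables (p : nat) (Q : finGroupType).
Hypotheses (p_pr : prime p) (pQ : p.-nat #|{: Q}|).
Implicit Types N T : {group Q}.

Definition normalT N := forall y, y \in 'N(N).

Lemma normalT_normal N : normalT N -> N <| [set: Q]%G.
Proof.
by move=> nN; rewrite /fingroup.normal finset.subsetT; apply/fintype.subsetP => y _.
Qed.

Lemma pgroupT (G : {group Q}) : p.-group G.
Proof.
apply: pnat_dvd pQ; rewrite -cardsT.
by apply: cardSg; apply: finset.subsetT.
Qed.

Lemma p_nat_coset_of N : p.-nat #|{: coset_of N}|.
Proof.
rewrite -cardsT; have pQN : p.-group (quotient [set: Q]%G N) by exact/quotient_pgroup/pgroupT.
have sub : [set: coset_of N]%SET \subset quotient [set: Q]%G N.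
  apply/fintype.subsetP => x _; have [y Ny ->] := cosetP x.
  by rewrite mem_quotient // inE.
exact: (pgroupS (G := quotient_group [set: Q]%G N) (H := [set: coset_of N]%G) sub pQN).
Qed.

(** The image of T in the p-group Q / N is a nontrivial normal subgroup, so it meets the center in
    an element of order p. *)
Lemma exists_central_mod N T : normalT N -> normalT T -> ~~ (T \subset N) ->
  exists z, [/\ z \in T, z \notin N, z ^+ p \in N & forall x, [~ z, x] \in N].
Proof.
move=> nN nT sTN.
have nQ : nilpotent (quotient [set: Q]%G N).
  by apply: (@pgroup_nil _ p); apply/quotient_pgroup/pgroupT.
have nTN : quotient T N <| quotient [set: Q]%G N by apply/quotient_normal/normalT_normal.
have TN1 : quotient T N :!=: 1.
  apply: contra sTN => /eqP TN1; rewrite -quotient_sub1 ?TN1 //.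
  by apply/fintype.subsetP => y _.
have := meet_center_nil nQ nTN TN1.
have pZ : p.-group (quotient T N :&: 'Z(quotient [set: Q]%G N)).
  by apply: pgroupS (finset.subsetIl _ _) _; apply/quotient_pgroup/pgroupT.
move=> ZT1; have [_ pd _] := pgroup_pdiv pZ ZT1; have [zb zbZ zbp] := Cauchy p_pr pd.
move: zbZ; rewrite inE => /andP[/morphimP[z Nz Tz zE] /centerP[_ zC]].
have zN k : z ^+ k \in N <-> zb ^+ k = 1.
  rewrite zE /= -morphX //; split=> [zkN|zk]; first exact: coset_id.
  by apply: coset_idr; rewrite // groupX.
exists z; split=> //.
- apply/negP; rewrite -[z]expg1 => /zN; rewrite expg1 => zb1.
  by have := prime_gt1 p_pr; rewrite -zbp zb1 order1.
- by apply/zN; rewrite -zbp expg_order.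
move=> x; apply: coset_idr; first by rewrite groupR.
rewrite morphR //=; apply/eqP/commgP; rewrite -[coset N z]/(coset_morphism N z) -zE.
by apply: zC; apply: mem_quotient; apply: finset.in_setT.
Qed.

Lemma mem_joing_cycle N z x : normalT N ->
  reflect (exists2 n, n \in N & exists k, x = n * z ^+ k) (x \in N <*> <[z]>).
Proof.
move=> nN; rewrite norm_joinEr; last by rewrite cycle_subG.
apply: (iffP mulsgP) => [[n y Nn /cycleP[k ->] ->]|[n Nn [k ->]]].
  by exists n => //; exists k.
by exists n (z ^+ k) => //; apply: mem_cycle.
Qed.

Lemma normalT_joing N z : normalT N -> (forall x, [~ z, x] \in N) ->
  normalT (N <*> <[z]>)%G.
Proof.
move=> nN zN y; apply/normP; apply/eqP; rewrite eqEcard cardJg leqnn andbT.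
apply/fintype.subsetP => _ /imsetP[x /(mem_joing_cycle _ _ nN)[n Nn [k ->]] ->].
rewrite conjMg groupM //; first by rewrite mem_gen // inE memJ_norm ?Nn.
rewrite conjXg groupX // -(mulVKg z (z ^ y)) -commgEl groupM //.
  by rewrite mem_gen // inE cycle_id orbT.
by rewrite mem_gen // inE zN.
Qed.

Lemma joing_cycle_central N z x y : normalT N -> (forall x, [~ z, x] \in N) ->
  x \in N <*> <[z]> -> [~ x, y] \in N.
Proof.
move=> nN zN /(mem_joing_cycle _ _ nN)[n Nn [k ->]].
apply: coset_idr => //; rewrite morphR //= morphM //= (coset_id Nn) mul1g morphX //=.
apply/eqP/commgP/commute_sym/commuteX/commute_sym/commgP; rewrite -morphR //=.
by rewrite coset_id.
Qed.

End CentralChains.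

Section CompatibleChains.
Variables (A B H : groupType) (i : hom H A) (j : hom H B).
Variables (QA QB : finGroupType) (al : hom A QA) (be : hom B QB).
Implicit Types (N : {group QA}) (M : {group QB}).

Definition agree N M := forall h, al (i h) \in N <-> be (j h) \in M.
Definition compatible N M := [/\ normalT N, normalT M & agree N M].

(** The strict inequality drives the induction. By the last clause every element of one factor that
    falls into the larger subgroup is congruent to an element of H, and through H it can be sent to
    the quotient of the other factor. *)
Definition central_step N M N' M' :=
  [/\ N \subset N' /\ M \subset M', forall x y, x \in N' -> [~ x, y] \in N,
      forall x y, x \in M' -> [~ x, y] \in M,
      (#|N| + #|M| < #|N'| + #|M'|)%N &
      (forall b, be b \in M' -> exists2 h, al (i h) \in N' & be (b / j h) \in M) \/
      (forall a, al a \in N' -> exists2 h, be (j h) \in M' & al (a / i h) \in N)].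
End CompatibleChains.

Section CentralStep.
Variables (A B H : groupType) (i : hom H A) (j : hom H B).
Variables (p : nat) (QA QB : finGroupType) (al : hom A QA) (be : hom B QB).
Hypotheses (pA : p.-nat #|{: QA}|).
Implicit Types (N : {group QA}) (M : {group QB}).

(** The central extension is made with E = QA / N. On A the map is the coset map; on B it replaces b
    by an element of H congruent to it modulo M and then passes to A. This is well defined because N
    and M agree on H. *)
Lemma separates_central_step N M N' M' :
    compatible i j al be N M -> N \subset N' -> M \subset M' ->
    (forall x y, x \in N' -> [~ x, y] \in N) ->
    (forall x y, x \in M' -> [~ x, y] \in M) ->
    (forall b, be b \in M' -> exists2 h, al (i h) \in N' & be (b / j h) \in M) ->
    separates_p i j p [set a | al a \in N'] [set b | be b \in M'] ->
  separates_p i j p [set a | al a \in N] [set b | be b \in M].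
Proof.
move=> [nN nM ag] sN sM cN cM cov sep.
pose lamA a := coset N (al a).
have /choice[c cP] b : exists h, be b \in M' -> al (i h) \in N' /\ be (b / j h) \in M.
  have [bM'|nb] := boolP (be b \in M'); last by exists 1.
  by have [h h1 h2] := cov b bM'; exists h.
pose lamB b := coset N (al (i (c b))).
have eqN h k : be (j (h / k)) \in M -> coset N (al (i h)) = coset N (al (i k)).
  move/ag; rewrite gmulfF gmulfF => hk; apply/divg1_eq.
  by rewrite -morphV //= -morphM ?groupV //=; apply: coset_id.
have be_coset b h : be (b / j h) \in M -> coset M (be b) = coset M (be (j h)).
  move=> hk; apply/divg1_eq; rewrite -morphV //= -morphM ?groupV //=.
  by rewrite -gmulfF; apply: coset_id.
have eqNc h k : coset M (be (j h)) = coset M (be (j k)) ->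
    coset N (al (i h)) = coset N (al (i k)).
  move=> e; apply: eqN; rewrite !gmulfF; apply: coset_idr; first by rewrite groupM ?groupV.
  by rewrite morphM ?groupV //= morphV //= e mulgV.
have cE b : be b \in M' -> coset M (be (j (c b))) = coset M (be b).
  by move=> /cP[_ /be_coset].
have := @separates_p_central A B H i j p _ _ (coset_of N) lamA lamB
  (p_nat_coset_of pA N) sep _ _ _ _ _.
move=> S; apply: separates_sub (S _ _ _ _ _).
- move=> a /= [_ la]; exact: coset_idr.
- move=> b /= [bM' lb]; have [_ bc] := cP b bM'.
  have : al (i (c b)) \in N by apply: coset_idr.
  by move/ag => jc; rewrite -(mulgVK (j (c b)) b) gmulfM groupM.
- by move=> k l _ _; rewrite /lamA gmulfM morphM.
- move=> k l kM lM; rewrite /lamB -morphM //= -!gmulfM; apply: eqNc.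
  rewrite cE; last by rewrite gmulfM groupM.
  by rewrite !gmulfM /= !morphM //= !cE.
- move=> k x kN; rewrite /lamA gmulfJ -(mulVKg (al k) (al k ^ al x)) -commgEl.
  by rewrite morphM //= (coset_id (cN _ _ kN)) mulg1.
- move=> k x kM; have kxM : be (k ^ x) \in M'.
    rewrite gmulfJ -(mulVKg (be k) (be k ^ be x)) -commgEl groupM //.
    exact/(fintype.subsetP sM)/cM.
  rewrite /lamB; apply: eqNc; rewrite !cE // gmulfJ.
  rewrite -(mulVKg (be k) (be k ^ be x)) -commgEl.
  by rewrite morphM //= (coset_id (cM _ _ kM)) mulg1.
by move=> h hN hM; rewrite /lamA /lamB; apply: eqNc; rewrite cE.
Qed.
End CentralStep.

Lemma compatible_swap (A B H : groupType) (i : hom H A) (j : hom H B)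
    (QA QB : finGroupType) (al : hom A QA) (be : hom B QB) N M :
  compatible i j al be N M -> compatible j i be al M N.
Proof. by case=> nN nM ag; split=> // h; rewrite ag. Qed.

Lemma central_step_swap (A B H : groupType) (i : hom H A) (j : hom H B)
    (QA QB : finGroupType) (al : hom A QA) (be : hom B QB) N M N' M' :
  central_step i j al be N M N' M' -> central_step j i be al M N M' N'.
Proof.
case=> [[sN sM] cN cM lt cov]; split=> //.
  by rewrite addnC [X in (_ < X)%N]addnC.
by case: cov; [right | left].
Qed.

Section ExtendOneSide.
Variables (A B H : groupType) (i : hom H A) (j : hom H B).
Variables (QA QB : finGroupType) (al : hom A QA) (be : hom B QB).
Implicit Types (N : {group QA}) (M : {group QB}).

Lemma normalT_commg (Q : finGroupType) (N : {group Q}) x y :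
  normalT N -> x \in N -> [~ x, y] \in N.
Proof. by move=> nN Nx; rewrite commgEl groupM ?groupV // memJ_norm. Qed.

Lemma joing_cycleS (Q : finGroupType) (N : {group Q}) z :
  z \notin N -> (#|N| < #|N <*> <[z]>|)%N.
Proof.
move=> zN; apply: proper_card; apply/properP; split; first exact: joing_subl.
by exists z => //; rewrite mem_gen // inE cycle_id orbT.
Qed.

(** As M does not grow, h = 1 serves as the covering element of H, and agreement persists because z
    catches nothing new from H. *)
Lemma extend_one_side N M z : compatible i j al be N M -> z \notin N ->
    (forall x, [~ z, x] \in N) ->
    (forall h, al (i h) \in N <*> <[z]> -> al (i h) \in N) ->
  compatible i j al be (N <*> <[z]>)%G M /\
  central_step i j al be N M (N <*> <[z]>)%G M.
Proof.
move=> [nN nM ag] zN zC zH; split.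
  split=> //; first exact: normalT_joing.
  move=> h; rewrite -ag; split; first exact: zH.
  by move=> hN; apply: (fintype.subsetP (joing_subl _ _)).
split; first by split=> //; apply: joing_subl.
- by move=> x y; apply: joing_cycle_central.
- by move=> x y; apply: normalT_commg.
- by rewrite ltn_add2r; apply: joing_cycleS.
left=> b bM; exists 1; rewrite !gmulf1 ?group1 //.
by rewrite invg1 mulg1.
Qed.

Lemma extend_both_sides N M h0 : compatible i j al be N M ->
    al (i h0) \notin N ->
    (forall x, [~ al (i h0), x] \in N) -> (forall x, [~ be (j h0), x] \in M) ->
  compatible i j al be (N <*> <[al (i h0)]>)%G (M <*> <[be (j h0)]>)%G /\
  central_step i j al be N M (N <*> <[al (i h0)]>)%G (M <*> <[be (j h0)]>)%G.
Proof.
move=> [nN nM ag] hN aC bC; have hM : be (j h0) \notin M by apply/negP => /ag; apply/negP.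
split.
  split; [exact: normalT_joing | exact: normalT_joing |].
  move=> h; split=> /mem_joing_cycle[] // n Nn [k hE].
    apply/mem_joing_cycle => //; exists (be (j h) / be (j h0) ^+ k); last first.
      by exists k; rewrite mulgVK.
    by rewrite -!gmulfXn -!gmulfF; apply/ag; rewrite !gmulfF !gmulfXn hE mulgK.
  apply/mem_joing_cycle => //; exists (al (i h) / al (i h0) ^+ k); last first.
    by exists k; rewrite mulgVK.
  by rewrite -!gmulfXn -!gmulfF; apply/ag; rewrite !gmulfF !gmulfXn hE mulgK.
split; first by split; apply: joing_subl.
- by move=> x y; apply: joing_cycle_central.
- by move=> x y; apply: joing_cycle_central.
- by rewrite -addSn leq_add // ?joing_cycleS // ltnW // joing_cycleS.
left=> b /mem_joing_cycle[] // m Mm [k bE]; exists (h0 ^+ k).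
  by rewrite !gmulfXn groupX // mem_gen // inE cycle_id orbT.
by rewrite gmulfF !gmulfXn bE mulgK.
Qed.

End ExtendOneSide.

Section Induction.
Variables (A B H : groupType) (i : hom H A) (j : hom H B).
Variables (p : nat) (QA QB : finGroupType) (al : hom A QA) (be : hom B QB).
Hypotheses (pA : p.-nat #|{: QA}|) (pB : p.-nat #|{: QB}|).

(** S is compatibility together with whatever else a case must preserve. The chain climbs from (N,
    M) to the full pair, where trivial homomorphisms suffice; the separating homomorphisms are
    lifted on the way back. *)
Lemma separates_chain (S : {group QA} -> {group QB} -> Prop) :
    (forall N M, S N M -> compatible i j al be N M) ->
    (forall N M, S N M -> (forall x, x \in N) /\ (forall y, y \in M) \/
      exists N' M', S N' M' /\ central_step i j al be N M N' M') ->
  forall N M, S N M ->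
  separates_p i j p [set a | al a \in N] [set b | be b \in M].
Proof.
move=> Sc Sstep N M; have [n] := ubnP (#|{: QA}| + #|{: QB}| - (#|N| + #|M|)).
elim: n N M => // n IH N M le_n SNM.
have [[NT MT]|[N' [M' [SNM' st]]]] := Sstep N M SNM.
  exists QA, (hom_of_morph (@trivial_hom A QA)), (hom_of_morph (@trivial_hom B QA)).
  by split=> // [a|b] _; [apply: NT | apply: MT].
have {}IH : separates_p i j p [set a | al a \in N'] [set b | be b \in M'].
  apply: IH => //; case: st => [_ _ _ lt _]; rewrite -ltnS; apply: leq_trans le_n.
  rewrite ltnS; apply: ltn_sub2l => //; apply: leq_trans lt _.
  by apply: leq_add; apply: max_card.
have cNM := Sc _ _ SNM; case: st => [[sN sM] cN cM _ [cov|cov]].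
  exact: separates_central_step sN sM cN cM cov IH.
apply/separates_swap; apply: separates_central_step sM sN cM cN cov _ => //.
  exact: compatible_swap.
exact: separates_swap.
Qed.

End Induction.

Section ChainCases.
Variables (A B H : groupType) (i : hom H A) (j : hom H B).
Variables (p : nat) (QA QB : finGroupType) (al : hom A QA) (be : hom B QB).
Hypotheses (p_pr : prime p) (pA : p.-nat #|{: QA}|) (pB : p.-nat #|{: QB}|).
Hypothesis (al_surj : surjective al).
Implicit Types (N : {group QA}) (M : {group QB}).

Let compat := compatible i j al be.
Let step := central_step i j al be.

Lemma normalT_setT (Q : finGroupType) : normalT [set: Q]%G.
Proof. by move=> y; apply: (fintype.subsetP (normG _)); apply: finset.in_setT. Qed.

Lemma full_or_central (Q : finGroupType) (N : {group Q}) :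
  p.-nat #|{: Q}| -> normalT N -> (forall x, x \in N) \/
  exists z, [/\ z \notin N, z ^+ p \in N & forall x, [~ z, x] \in N].
Proof.
move=> pQ nN; have [sN|nsN] := boolP ([set: Q]%G \subset N).
  by left=> x; apply: (fintype.subsetP sN); apply: finset.in_setT.
have [z [_ zN zp zC]] := exists_central_mod p_pr pQ nN (@normalT_setT Q) nsN.
by right; exists z.
Qed.

(** Once M is everything, agreement puts the image of H inside N, so any central z extends N
    alone. *)
Lemma step_full_right N M : compat N M -> (forall y, y \in M) ->
  (forall x, x \in N) /\ (forall y, y \in M) \/
  exists N' M', compat N' M' /\ step N M N' M'.
Proof.
move=> cNM MT; have [nN nM ag] := cNM.
have [NT|[z [zN _ zC]]] := full_or_central pA nN; [by left | right].
exists (N <*> <[z]>)%G, M; apply: extend_one_side => // h _.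
exact/ag.
Qed.

Lemma extend_right N M z : compat N M -> z \notin M ->
    (forall x, [~ z, x] \in M) ->
    (forall h, be (j h) \in M <*> <[z]> -> be (j h) \in M) ->
  compat N (M <*> <[z]>)%G /\ step N M N (M <*> <[z]>)%G.
Proof.
move=> /compatible_swap cMN zM zC zH.
have [c s] := extend_one_side cMN zM zC zH.
by split; [apply: compatible_swap | apply: central_step_swap].
Qed.

(** The steps are dictated by B. If z catches a new element h0 of H, the images of h0 are adjoined
    on both sides instead of z: on the side of A they are central because H is central in A and [al]
    is surjective. *)
Lemma separates_chain_central N M : range i `<=` center A -> compat N M ->
  separates_p i j p [set a | al a \in N] [set b | be b \in M].
Proof.
move=> iC; move: N M; apply: (separates_chain pA pB) => // N M cNM.
have [nN nM ag] := cNM.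
have [MT|[z [zM _ zC]]] := full_or_central pB nM; first exact: step_full_right.
right; have [zH|] := EM (forall h, be (j h) \in M <*> <[z]> -> be (j h) \in M).
  by exists N, (M <*> <[z]>)%G; apply: extend_right.
move=> /existsNP[h0 /not_implyP[hz /negP hM]].
exists (N <*> <[al (i h0)]>)%G, (M <*> <[be (j h0)]>)%G.
apply: extend_both_sides => // [|x|y]; first by apply/negP => /ag; apply/negP.
  have [a _ <-] : range al x by rewrite al_surj.
  have /eqP ca : [~ i h0, a] == 1 by apply/commgP/iC; exists h0.
  by rewrite -gmulfR ca gmulf1.
exact: (joing_cycle_central y nM zC hz).
Qed.

Lemma joing_cycle_exp (Q : finGroupType) (N : {group Q}) z x k : normalT N ->
  (forall y, [~ z, y] \in N) -> z ^+ k \in N -> x \in N <*> <[z]> -> x ^+ k \in N.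
Proof.
move=> nN zC zk /(mem_joing_cycle _ _ nN)[n Nn [l ->]].
apply: coset_idr => //; rewrite morphX //= morphM //= (coset_id Nn) mul1g morphX //=.
by rewrite -expgM mulnC expgM -morphX //= (coset_id zk) expg1n.
Qed.

(** Speaking of finite images allows [<[f c]>] and natural exponents in place of integer powers in
    H. *)
Lemma locally_cyclic_pair h k : locally_cyclic H ->
  exists c, forall (Q : finGroupType) (f : hom H Q),
    f h \in <[f c]> /\ f k \in <[f c]>.
Proof.
move=> /(_ [set h; k])[]; first exact: finite_set2.
move=> c cE; exists c => Q f.
have sub : subgroup [set x | f x \in (<[f c]>)].
  split=> [|x y]; rewrite /= ?gmulf1 ?group1 // => xc yc.
  by rewrite gmulfF groupM ?groupV.
have inc x : [set h; k] x -> f x \in <[f c]>.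
  move=> hx; have : generated [set h; k] x by move=> K [_]; apply.
  rewrite cE => gx; apply: (gx [set x | f x \in (<[f c]>)]); split=> // _ ->.
  by rewrite /= cycle_id.
by split; apply: inc; [left | right].
Qed.

Lemma separates_chain_locally_cyclic N M : locally_cyclic H -> compat N M ->
  separates_p i j p [set a | al a \in N] [set b | be b \in M].
Proof.
move=> Hlc; move: N M; apply: (separates_chain pA pB) => // N M cNM.
have [nN nM ag] := cNM.
have [MT|[w [wM wp wC]]] := full_or_central pB nM; first exact: step_full_right.
have [NT|[z [zN zp zC]]] := full_or_central pA nN.
  right; exists N, (M <*> <[w]>)%G; apply: extend_right => // h _; exact/ag.
right; have [wH|] := EM (forall h, be (j h) \in M <*> <[w]> -> be (j h) \in M).
  by exists N, (M <*> <[w]>)%G; apply: extend_right.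
move=> /existsNP[h2 /not_implyP[h2w /negP h2M]].
have [zH|] := EM (forall h, al (i h) \in N <*> <[z]> -> al (i h) \in N).
  by exists (N <*> <[z]>)%G, M; apply: extend_one_side.
move=> /existsNP[h1 /not_implyP[h1z /negP h1N]].
have h2N : al (i h2) \notin N by apply/negP => /ag; apply/negP.
(* Modulo N the images of h1 and h2 both have order p and lie in one cyclic group, generated by the
   image of c. Such a group has only one subgroup of order p, so z catches h2 as well. *)
have h2z : al (i h2) \in N <*> <[z]>.
  have [c cP] := locally_cyclic_pair h1 h2 Hlc.
  have fM : {morph (fun h => coset N (al (i h))) : x y / x * y}.
    by move=> x y; rewrite !gmulfM morphM.
  have [/= c1 c2] := cP _ (hom_of_morph fM).
  have ordp h : al (i h) \notin N -> al (i h) ^+ p \in N -> #[coset N (al (i h))] = p.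
    move=> hN hp; apply: (prime_nt_dvdP p_pr) => //.
      by rewrite order_eq1; apply: contra hN => /eqP/coset_idr; apply.
    by rewrite order_dvdn -morphX //= coset_id.
  have o1 := ordp h1 h1N (joing_cycle_exp nN zC zp h1z).
  have o2 : #[coset N (al (i h2))] = p.
    apply: ordp => //; rewrite -!gmulfXn; apply/ag; rewrite !gmulfXn.
    exact: (joing_cycle_exp nM wC wp h2w).
  have cyc : <[coset N (al (i h1))]> = <[coset N (al (i h2))]>.
    apply/eqP; rewrite (eq_subG_cyclic (cycle_cyclic (coset N (al (i c))))).
    - by rewrite -!orderE o1 o2.
    - by rewrite cycle_subG.
    by rewrite cycle_subG.
  have : coset N (al (i h2)) \in <[coset N (al (i h1))]> by rewrite cyc cycle_id.
  move=> /cycleP[k kE].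
  have : al (i h2) / al (i h1) ^+ k \in N.
    apply: coset_idr; first by rewrite groupM ?groupV.
    by rewrite morphM ?groupV //= morphV //= morphX //= kE mulgV.
  move=> h21; rewrite -(mulgVK (al (i h1) ^+ k) (al (i h2))) groupM ?groupX //.
  exact: (fintype.subsetP (joing_subl _ _)).
exists (N <*> <[al (i h2)]>)%G, (M <*> <[be (j h2)]>)%G.
apply: extend_both_sides => // [x|y].
  exact: (joing_cycle_central x nN zC h2z).
exact: (joing_cycle_central y nM wC h2w).
Qed.

(** As long as the kernel of [theta] has an image outside N, a central z is taken from it; by the
    invariant, z adds nothing from H. Afterwards every a is congruent to i(theta a) modulo N, so QA
    / N is an image of H, and centrality modulo M of an element of H passes to N by agreement. *)
Lemma separates_chain_retract (theta : hom A H) N M :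
    (forall h, theta (i h) = h) -> compat N M ->
    (forall a, al a \in N -> al (i (theta a)) \in N) ->
  separates_p i j p [set a | al a \in N] [set b | be b \in M].
Proof.
move=> thK; pose S N M := compat N M /\ forall a, al a \in N -> al (i (theta a)) \in N.
move=> cNM tN; have SNM : S N M by split.
move: N M SNM {cNM tN}; apply: (separates_chain pA pB) => [N M []//|N M [cNM tN]].
have [nN nM ag] := cNM.
have [[a0 ta0 /negP a0N]|noa] := pselect (exists2 a, theta a = 1 & ~ (al a \in N)).
  right.
  pose T : {set QA} := [set q : QA | `[< exists2 a, theta a = 1 & al a = q >]]%SET.
  have gT : group_set T.
    apply/group_setP; split; first by rewrite !inE; exists 1; rewrite gmulf1.
    move=> x y; rewrite !inE => -[a ta <-] [b tb <-].
    by exists (a * b); rewrite gmulfM // ta tb mulg1.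
  have nT : normalT (Group gT).
    move=> y; have [b _ <-] : range al y by rewrite al_surj.
    rewrite inE; apply/fintype.subsetP => _ /imsetP[x xT ->].
    move: xT; rewrite !inE => -[a ta <-].
    by exists (a ^ b); rewrite gmulfJ // ta conj1g.
  have nsT : ~~ (Group gT \subset N).
    by apply: contra a0N => /fintype.subsetP; apply; rewrite !inE; exists a0.
  have [z [zT zN _ zC]] := exists_central_mod p_pr pA nN nT nsT.
  move: zT; rewrite !inE => -[a1 ta1 a1z].
  have zk a : al a \in N <*> <[z]> -> al (i (theta a)) \in N.
    move=> /(mem_joing_cycle _ _ nN)[n Nn [k aE]].
    have : al (a / a1 ^+ k) \in N by rewrite gmulfF gmulfXn a1z aE mulgK.
    by move=> /tN; rewrite gmulfF gmulfXn ta1 expg1n invg1 mulg1.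
  have [||||c s] := @extend_one_side A B H i j QA QB al be N M z => //.
    by move=> h /zk; rewrite thK.
  exists (N <*> <[z]>)%G, M; split=> //; split=> // a /zk.
  exact: (fintype.subsetP (joing_subl _ _)).
have thE a : al (a / i (theta a)) \in N.
  apply: contrapT => naN; apply: noa; exists (a / i (theta a)) => //.
  by rewrite gmulfF thK mulgV.
have [MT|[z [zM _ zC]]] := full_or_central pB nM.
  left; split=> // x; have [a _ <-] : range al x by rewrite al_surj.
  rewrite -(mulgVK (i (theta a)) a) gmulfM groupM ?thE //; exact/ag.
right; have [zH|] := EM (forall h, be (j h) \in M <*> <[z]> -> be (j h) \in M).
  by have [c s] := extend_right cNM zM zC zH; exists N, (M <*> <[z]>)%G; split.
move=> /existsNP[h0 /not_implyP[hz /negP hM]].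
have hN : al (i h0) \notin N by apply/negP => /ag; apply/negP.
have cM y : [~ be (j h0), y] \in M by exact: (joing_cycle_central y nM zC hz).
have cN x : [~ al (i h0), x] \in N.
  have [a _ <-] : range al x by rewrite al_surj.
  have : [~ al (i h0), al (i (theta a))] \in N.
    by rewrite -!gmulfR; apply/ag; rewrite !gmulfR.
  have e : coset N (al a) = coset N (al (i (theta a))).
    apply/divg1_eq; rewrite -morphV //= -morphM ?groupV //= -gmulfF.
    exact: coset_id.
  move=> /coset_id; rewrite morphR //= -e -morphR //=.
  by apply: coset_idr; rewrite groupR.
have [c s] := extend_both_sides cNM hN cN cM.
exists (N <*> <[al (i h0)]>)%G, (M <*> <[be (j h0)]>)%G; split=> //; split=> // a aN.
rewrite -(mulVKg (al a) (al (i (theta a)))) groupM //.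
apply: (fintype.subsetP (joing_subl _ _)).
by have := thE a^-1; rewrite gmulfM !gmulfV invgK.
Qed.

End ChainCases.

(** * The pro-p topology of H and the starting pairs of the chains *)

Definition p_topology_induced (p : nat) (H A : groupType) (i : hom H A) :=
  forall U : set H, subgroup U -> (forall h, exists k, U (h ^+ (p ^ k))) ->
  exists (Q : finGroupType) (f : hom A Q),
    p.-nat #|{: Q}| /\ forall h, f (i h) = 1 -> U h.

Lemma bounded_p_topology_induced (P : nat_pred) (p : nat) (H A : groupType)
    (i : hom H A) : prime p -> p \in P -> injective i ->
  maps_to_bounded_injectively_on P (range i) -> p_topology_induced p i.
Proof.
move=> p_pr Pp i_inj [X [s [bX _ s_inj]]] U sU HU.
have [n nX] : exists n, nilpotent_length n X.
  by apply: nilpotent_group_length; have [m [Z [cZ _]]] := bX; exists m, Z.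
have sH : subgroup (range (s \o i)) by exact: range_subgroup.
have [||Q [f [pQ _ fU]]] := p_quotient_separating p_pr nX
    (bounded_p_torsion_finite bX Pp) sH (subgroup_image (s \o i) sU).
- by move=> _ [h _ <-]; exists h.
- move=> _ [h _ <-]; have [k Uk] := HU h.
  by exists k, (h ^+ (p ^ k)) => //; rewrite gmulfXn.
exists Q, (f \o s); split=> // h /= fh.
have rh : range (s \o i) (s (i h)) by exists h.
have [u Uu /= su] := fU _ rh fh.
by have /i_inj <- : i u = i h by apply: s_inj.
Qed.

Lemma p_nat_exponent (p : nat) (Q : finGroupType) : p.-nat #|{: Q}| ->
  exists k, forall q : Q, q ^+ (p ^ k) = 1.
Proof.
move=> /p_natP[k kE]; exists k => q; rewrite -kE -cardsT.
by apply: expg_cardG; apply: finset.in_setT.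
Qed.

(** The elements of H killed by [be0] form a subgroup containing all p^k-th powers for some k, so a
    finite p-quotient of A detects it; [al] combines this quotient with [al0]. *)
Lemma p_topology_kernel (p : nat) (H A B : groupType) (i : hom H A) (j : hom H B)
    (QB QA : finGroupType) (al0 : hom A QA) (be0 : hom B QB) :
    p_topology_induced p i -> p.-nat #|{: QA}| -> p.-nat #|{: QB}| ->
  exists (Q : finGroupType) (al : hom A Q), [/\ p.-nat #|{: Q}|, surjective al,
    forall a, al a = 1 -> al0 a = 1 & forall h, al (i h) = 1 -> be0 (j h) = 1].
Proof.
move=> ind pA pB; have [|h|Q1 [f [p1 fU]]] := ind (kernel (be0 \o j)).
- by case: (kernel_normal (be0 \o j)).
- have [k kE] := p_nat_exponent pB; exists k.
  by rewrite /kernel /= !gmulfXn kE.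
have [Q [al [pQ als alE]]] := hom_pair al0 f pA p1.
by exists Q, al; split=> // x /alE[] // _ /fU.
Qed.

Section Cases.
Variables (A B H : groupType) (i : hom H A) (j : hom H B) (p : nat).
Hypotheses (p_pr : prime p).
Hypotheses (ind_i : p_topology_induced p i) (ind_j : p_topology_induced p j).
Variables (QA QB : finGroupType) (al0 : hom A QA) (be0 : hom B QB).
Hypotheses (pA : p.-nat #|{: QA}|) (pB : p.-nat #|{: QB}|).

Let trivN (Q : finGroupType) : normalT (1%G : {group Q}).
Proof. by move=> y; rewrite norm1 finset.in_setT. Qed.

(** On H the kernel of [al] lies in that of [be], which lies in that of [al0]. The chain starts at M
    = 1 and at N, the [al]-image of the elements of H killed by [be]; centrality of H makes N
    normal, and the two inclusions give agreement and the bound on the kernel. *)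
Lemma separates_central : range i `<=` center A ->
  separates_p i j p (kernel al0) (kernel be0).
Proof.
move=> iC.
have [QB' [be [pB' _ be_be0 be_al0]]] := p_topology_kernel i be0 al0 ind_j pB pA.
have [QA' [al [pA' als al_al0 al_be]]] := p_topology_kernel j al0 be ind_i pA pB'.
pose N := [set q : QA' | `[< exists2 h, be (j h) = 1 & al (i h) = q >]]%SET.
have gN : group_set N.
  apply/group_setP; split; first by rewrite !inE; exists 1; rewrite !gmulf1.
  move=> x y; rewrite !inE => -[h bh <-] [k bk <-].
  by exists (h * k); rewrite !gmulfM // bh bk mulg1.
have := @separates_chain_central A B H i j p QA' QB' al be p_pr pA' pB' als
  (Group gN) 1%G iC.
move=> S; apply: separates_sub (S _).
- move=> a /=; rewrite !inE => -[h bh alh]; apply/divg1_eq.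
  have : al (a / i h) = 1 by rewrite gmulfF alh mulgV.
  by move=> /al_al0; rewrite gmulfF (be_al0 _ bh).
- by move=> b /= /set1P/be_be0.
split=> //.
  move=> y; have [a _ <-] : range al y by rewrite als.
  rewrite inE; apply/fintype.subsetP => _ /imsetP[x xN ->].
  move: xN; rewrite !inE => -[h bh <-]; exists h => //.
  rewrite -gmulfJ; congr (al _); by rewrite conjgE (iC (i h)) ?mulKg.
move=> h; split=> [|bh]; last by rewrite !inE; exists h => //; apply/set1P.
rewrite !inE => -[k bk alk]; apply/eqP.
have : al (i (h / k)) = 1 by rewrite !gmulfF alk mulgV.
by move=> /al_be; rewrite !gmulfF bk => /divg1_eq.
Qed.

(** The component of [al] through [theta] makes its kernel on H equal to that of [be], so the chain
    can start at the pair of trivial subgroups. *)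
Lemma separates_retract (theta : hom A H) : (forall h, theta (i h) = h) ->
  separates_p i j p (kernel al0) (kernel be0).
Proof.
move=> thK.
have [QB' [be [pB' _ be_be0 be_al0]]] := p_topology_kernel i be0 al0 ind_j pB pA.
have [QA' [al [pA' als alE]]] := hom_pair al0 (be \o (j \o theta)) pA pB'.
have := @separates_chain_retract A B H i j p QA' QB' al be p_pr pA' pB' als
  theta 1%G 1%G thK.
move=> S; apply: separates_sub (S _ _).
- by move=> a /= /set1P/alE[].
- by move=> b /= /set1P/be_be0.
- split=> // h; split=> /set1P; last first.
    by move=> bh; apply/set1P/alE; rewrite /= thK bh be_al0.
  by move=> /alE[_ /=]; rewrite thK => ->; apply/set1P.
move=> a /set1P/alE[_ /= bta]; apply/set1P/alE; rewrite /= thK bta.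
by rewrite (be_al0 _ bta).
Qed.

(* Among the normal subgroups of the quotient of A contained in al0's kernel and
   meeting H inside the kernel of [be], a maximal one meets H exactly there:
   the subgroups of a cyclic p-group form a chain. *)
Lemma separates_locally_cyclic : locally_cyclic H ->
  separates_p i j p (kernel al0) (kernel be0).
Proof.
move=> Hlc.
have [QB' [be [pB' _ be_be0 be_al0]]] := p_topology_kernel i be0 al0 ind_j pB pA.
have [QA' [al [pA' als al_al0 al_be]]] := p_topology_kernel j al0 be ind_i pA pB'.
pose K := [set q : QA' | `[< exists2 a, al0 a = 1 & al a = q >]]%SET.
have gK : group_set K.
  apply/group_setP; split; first by rewrite !inE; exists 1; rewrite !gmulf1.
  move=> x y; rewrite !inE => -[a ta <-] [b tb <-].
  by exists (a * b); rewrite !gmulfM // ta tb mulg1.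
have nK : normalT (Group gK).
  move=> y; have [b _ <-] : range al y by rewrite als.
  rewrite inE; apply/fintype.subsetP => _ /imsetP[x xT ->].
  move: xT; rewrite !inE => -[a ta <-].
  by exists (a ^ b); rewrite gmulfJ // ta conj1g.
have be1 h k : al (i h) = al (i k) -> be (j k) = 1 -> be (j h) = 1.
  move=> alk bk; have : al (i (h / k)) = 1 by rewrite !gmulfF alk mulgV.
  by move=> /al_be; rewrite !gmulfF bk => /divg1_eq.
pose ok (N : {group QA'}) := `[< [/\ normalT N, N \subset Group gK &
  forall h, al (i h) \in N -> be (j h) = 1] >].
have ok1 : ok 1%G.
  apply: asboolT; split; [exact: trivN | exact: (sub1G (Group gK)) |].
  by move=> h /set1P h1; apply: (be1 h 1); rewrite ?gmulf1.
case: (@arg_maxnP _ 1%G ok (fun N : {group QA'} => #|N|) ok1) => N /asboolW[nN NK NH] Nmax.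
have NV h : be (j h) = 1 -> al (i h) \in N.
  move=> bh; apply: contrapT => /negP hN.
  have nKN : ~~ (Group gK \subset N).
    apply: contra hN => /fintype.subsetP; apply; rewrite !inE.
    by exists (i h) => //; apply: be_al0.
  have [z [zK zN zp zC]] := exists_central_mod p_pr pA' nN nK nKN.
  (* By maximality of N, adjoining z must catch some k in H that [be] does not kill. *)
  have [k kz kb] : exists2 k, al (i k) \in N <*> <[z]> & be (j k) <> 1.
    apply: contrapT => nok; have := Nmax (N <*> <[z]>)%G.
    have -> : ok (N <*> <[z]>)%G.
      apply: asboolT; split; first exact: normalT_joing.
        apply/fintype.subsetP => _ /(mem_joing_cycle _ _ nN)[n Nn [l ->]].
        by rewrite groupM ?groupX // (fintype.subsetP NK).
      by move=> k kz; apply: contrapT => kb; apply: nok; exists k.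
    by move=> /(_ isT); rewrite /= leqNgt joing_cycleS.
  have kN : al (i k) \notin N by apply/negP => /NH.
  have kp : al (i k) ^+ p \in N := joing_cycle_exp nN zC zp kz.
  have [c cP] := locally_cyclic_pair h k Hlc.
  have [/= hc kc] := cP _ (al \o i).
  have powb (l m : nat) (u v : H) : al (i u) = al (i v) ^+ l -> be (j v) = 1 -> be (j u) = 1.
    by move=> uv bv; apply: (be1 u (v ^+ l)); rewrite !gmulfXn ?bv ?expg1n.
  have cyc := cycle_cyclic (al (i c)).
  have sub x : al (i x) \in <[al (i c)]> -> <[al (i x)]> \subset <[al (i c)]>.
    by rewrite cycle_subG.
  (* Whichever subgroup is the smaller, k turns out to be a power of h: exactly in the first case,
     modulo N in the second, where both have order p. As [be] kills h and the elements of H falling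
     into N, it kills k, a contradiction. *)
  have /orP[] : (<[al (i k)]> \subset <[al (i h)]>) || (<[al (i h)]> \subset <[al (i k)]>).
    have e x y : al (i x) \in <[al (i c)]> -> al (i y) \in <[al (i c)]> ->
        (<[al (i x)]> \subset <[al (i y)]>) = (#|<[al (i x)]>| %| #|<[al (i y)]>|).
      by move=> /sub sx /sub sy; rewrite (cardSg_cyclic cyc sx sy).
    rewrite !e //.
    have /p_natP[m ->] : p.-nat #|<[al (i h)]>| by exact: pgroupT.
    have /p_natP[n ->] : p.-nat #|<[al (i k)]>| by exact: pgroupT.
    by have [le|lt] := leqP n m; [rewrite dvdn_exp2l | rewrite (dvdn_exp2l _ (ltnW lt)) orbT].
  - by rewrite cycle_subG => /cycleP[m kE]; apply: kb; apply: (powb m 0 k h).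
  rewrite cycle_subG => /cycleP[m hE].
  have o1 : #[coset N (al (i k))] = p.
    apply: (prime_nt_dvdP p_pr); last by rewrite order_dvdn -morphX //= coset_id.
    by rewrite order_eq1; apply: contra kN => /eqP/coset_idr; apply.
  have o2 : #[coset N (al (i h))] = p.
    apply: (prime_nt_dvdP p_pr).
      by rewrite order_eq1; apply: contra hN => /eqP/coset_idr; apply.
    rewrite order_dvdn -morphX //= coset_id // hE -expgM mulnC expgM.
    by rewrite groupX.
  have ck : coset N (al (i h)) \in <[coset N (al (i k))]>.
    by rewrite hE morphX //= mem_cycle.
  have : <[coset N (al (i h))]> == <[coset N (al (i k))]>.
    by rewrite eqEcard cycle_subG ck -!orderE o1 o2 leqnn.
  move=> /eqP cE; have : coset N (al (i k)) \in <[coset N (al (i h))]>.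
    by rewrite cE cycle_id.
  move=> /cycleP[l kE].
  have : al (i (k / h ^+ l)) \in N.
    apply: coset_idr => //; rewrite !gmulfF !gmulfXn morphM ?groupV //=.
    by rewrite morphV //= morphX //= kE mulgV.
  by move=> /NH; rewrite !gmulfF !gmulfXn bh expg1n invg1 mulg1.
have := @separates_chain_locally_cyclic A B H i j p QA' QB' al be p_pr pA' pB'
  N 1%G Hlc.
move=> S; apply: separates_sub (S _).
- move=> a /= /(fintype.subsetP NK); rewrite !inE => -[b tb ab]; apply/divg1_eq.
  have : al (a / b) = 1 by rewrite gmulfF ab mulgV.
  by move=> /al_al0; rewrite gmulfF tb.
- by move=> b /= /set1P/be_be0.
by split=> // h; split=> [/NH bh|/set1P/NV//]; apply/set1P.
Qed.

End Cases.

Lemma retract_hom (A H : groupType) (i : hom H A) : injective i ->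
  retract (range i) -> exists theta : hom A H, forall h, theta (i h) = h.
Proof.
move=> i_inj [S [nS Sdisj Sgen]].
have /choice[t tP] a : exists h, S (a / i h).
  by have [s [_ [Ss [h _ <-] ->]]] := Sgen a; exists h; rewrite mulgK.
have tE a h : S (a / i h) -> t a = h.
  move=> Sh; apply: i_inj; apply/divg1_eq.
  have : (S `&` range i) (i (t a) / i h).
    split; last by exists (t a / h); rewrite ?gmulfF.
    have -> : i (t a) / i h = (a / i (t a))^-1 * (a / i h) by rewrite invgF divgKA.
    by apply: subgroupM nS.1 _ Sh; apply: subgroupV nS.1 _.
  by rewrite Sdisj.
have tM : {morph t : a b / a * b}.
  move=> a b; apply: tE; rewrite gmulfM.
  have -> : a * b / (i (t a) * i (t b)) = (b / i (t b)) ^ a^-1 * (a / i (t a)).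
    by rewrite conjgE !gnorm.
  by apply: subgroupM nS.1 (normalJ _ nS (tP b)) (tP a).
exists (hom_of_morph tM) => h; apply: tE; rewrite mulgV.
exact: subgroup1 nS.1.
Qed.

Lemma separates_kernels (A B H : groupType) (i : hom H A) (j : hom H B) (p : nat)
    (QA QB : finGroupType) (al0 : hom A QA) (be0 : hom B QB) :
    prime p -> injective i -> injective j ->
    p_topology_induced p i -> p_topology_induced p j ->
    p.-nat #|{: QA}| -> p.-nat #|{: QB}| ->
    [\/ locally_cyclic H,
        range i `<=` center A \/ range j `<=` center B |
        retract (range i) \/ retract (range j)] ->
  separates_p i j p (kernel al0) (kernel be0).
Proof.
move=> p_pr i_inj j_inj ind_i ind_j pA pB [Hlc|[iC|jC]|[iR|jR]].
- exact: separates_locally_cyclic.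
- exact: separates_central.
- by apply/separates_swap; apply: separates_central.
- by have [theta thK] := retract_hom i_inj iR; apply: separates_retract thK.
have [theta thK] := retract_hom j_inj jR.
by apply/separates_swap; apply: separates_retract thK.
Qed.

(** * Words in the free product *)

Section AlternatingWords.
Variables (T : eqType) (R : groupType) (r : T -> R).

Definition alt_letter (b : bool) (x : T) : R := if b then (r x)^-1 else r x.

Fixpoint alt_prefix (x : nat -> T) (n : nat) : R :=
  if n is n'.+1 then alt_prefix x n' * alt_letter (odd n') (x n') else 1.

Fixpoint alt_word (b : bool) (s : seq T) : R :=
  if s is x :: s' then alt_letter b x * alt_word (~~ b) s' else 1.

Lemma alt_word_rcons b s x :
  alt_word b (rcons s x) = alt_word b s * alt_letter (b (+) odd (size s)) x.
Proof.
elim: s b => [|y s IH] b /=; first by rewrite mulg1 mul1g addbF.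
by rewrite IH mulgA addNb -addbN.
Qed.

Lemma alt_word_mkseq x n : alt_word false (mkseq x n) = alt_prefix x n.
Proof.
by elim: n => // n IH; rewrite mkseqS alt_word_rcons IH size_mkseq.
Qed.
End AlternatingWords.

(* The vertices of the path read off from the word in the Cayley graph of R are
   separated one after the other: the last edge is traversed only once, so a
   function supported on that edge gives a wreath product that separates the
   last vertex from the previous ones. *)
Lemma alternating_word_separated (p : nat) (T : eqType) (x : nat -> T) n :
    prime p -> (forall k, (k.+1 < n)%N -> x k <> x k.+1) ->
  exists (R : finGroupType) (r : T -> R), p.-nat #|{: R}| /\
    forall k l, (k <= n)%N -> (l <= n)%N ->
      alt_prefix r x k = alt_prefix r x l -> k = l.
Proof.
pose E : finGroupType := 'I_(Zp_trunc p).+2.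
move=> p_pr; have pE : p.-nat #|{: E}|.
  by rewrite card_ord Zp_cast ?prime_gt1 // pnat_id.
elim: n => [|m IH] xn.
  exists E, (fun=> 1); split; first by [].
  by case=> // -[].
have [|R [r [pR rP]]] := IH; first by move=> k km; apply: xn; apply: ltnW.
pose z : E := Zp1.
have z1 : z <> 1 by move=> /(congr1 val) /=; rewrite modn_small.
set P := alt_prefix r x in rP.
(* The starting point of the last edge, which runs from q to q r(x m): this is P m if the edge is
   traversed forwards, and the final vertex if it is traversed backwards. *)
pose Q := if odd m then P m * (r (x m))^-1 else P m.
pose r' t : wreath E R := ([ffun q => if (t == x m) && (q == Q) then z else 1], r t).
have PS k : P k.+1 = P k * alt_letter r (odd k) (x k) by [].
have P2 k : (alt_prefix r' x k).2 = P k.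
  elim: k => // k IHk; rewrite [alt_prefix r' x _]/= wreath_mulE2 IHk PS /alt_letter.
  by case: (odd k).
have r1 t q : (r' t).1 q = if (t == x m) && (q == Q) then z else 1 by rewrite ffunE.
have step k : (alt_prefix r' x k.+1).1 1 = (alt_prefix r' x k).1 1 *
    (if odd k then ((r' (x k)).1 (P k.+1))^-1 else (r' (x k)).1 (P k)).
  rewrite [alt_prefix r' x k.+1]/= wreath_mulE1 P2 mul1g; congr (_ * _).
  by rewrite PS /alt_letter; case: (odd k); rewrite ?wreath_invE1.
(* An earlier step along the last edge in the same direction would start at P m, so k = m. In the
   opposite direction it would end at P m, so k + 1 = m, and x k = x m contradicts the hypothesis on
   neighbours. *)
have P1 k : (k <= m)%N -> (alt_prefix r' x k).1 1 = 1.
  elim: k => [|k IHk] lt_km; first by rewrite wreath_oneE1.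
  have xkm : k.+1 = m -> x k == x m -> False.
    by move=> km /eqP; rewrite -km; apply: xn; rewrite km.
  rewrite step IHk 1?ltnW // mul1g !r1 /Q; have := PS k; rewrite /alt_letter.
  have [xe|] := eqVneq (x k) (x m); last by rewrite /= invg1; case: (odd k).
  have kP := rP k m (ltnW lt_km) (leqnn m); have kP' := rP k.+1 m lt_km (leqnn m).
  rewrite xe; case: (odd k) (odd m) => -[] /= PSk.
  - case: eqP => [e|]; last by rewrite invg1.
    have km : k = m by apply: kP; apply: (mulIg (r (x m))^-1); rewrite -PSk.
    by rewrite km ltnn in lt_km.
  - case: eqP => [/kP' e|]; last by rewrite invg1.
    by case: (xkm e); rewrite xe.
  - case: eqP => // e; case: (xkm); last by rewrite xe.
    by apply: kP'; rewrite PSk e mulgVK.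
  by case: eqP => // /kP e; rewrite e ltnn in lt_km.
have Pm : (alt_prefix r' x m.+1).1 1 <> 1.
  rewrite step P1 // mul1g !r1 eqxx PS /alt_letter /Q.
  by case: (odd m); rewrite eqxx //= => /eqP; rewrite invg_eq1 => /eqP.
exists (wreath E R), r'; split.
  by rewrite card_wreath pnatM pnatX pR pE.
move=> k l; rewrite (leq_eqVlt k) (leq_eqVlt l) !ltnS => /orP[/eqP->|km] /orP[/eqP->|lm] // e.
- by case: Pm; rewrite e P1.
- by case: Pm; rewrite -e P1.
by apply: rP => //; rewrite -!P2 e.
Qed.

Section AmalgamWords.
Variables (A B H G : groupType).
Variables (i : hom H A) (j : hom H B) (a : hom A G) (b : hom B G).
Hypothesis hG : generalized_free_product i j a b.

(** Generation follows from the universal property: [a] and [b] factor through the subgroup S, and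
    the composite of G to S to G is the identity by uniqueness. *)
Lemma amalgam_ind (S : set G) : subgroup S ->
  (forall x, S (a x)) -> (forall y, S (b y)) -> forall g, S g.
Proof.
move=> sS Sa Sb g; have [_ _ abH univ] := hG.
have [Y [f [f_inj fE]]] := exists_subgroup_hom sS.
have lift (X : groupType) (c : hom X G) : (forall x, S (c x)) ->
    exists c' : hom X Y, forall x, f (c' x) = c x.
  move=> Sc; have /choice[t tE] x : exists y, f y = c x.
    by have [y _ <-] : range f (c x) by [rewrite fE]; exists y.
  have tM : {morph t : x y / x * y}.
    by move=> x y; apply: f_inj; rewrite gmulfM !tE gmulfM.
  by exists (hom_of_morph tM).
have [a' a'E] := lift A a Sa; have [b' b'E] := lift B b Sb.
have [|u [[ua ub] _]] := univ Y a' b'.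
  by move=> h; apply: f_inj; rewrite a'E b'E.
have [v [_ vE]] := univ G a b abH.
have idM : {morph (fun x : G => x) : x y / x * y} by [].
have fu : (f \o u) g = g.
  rewrite (vE (f \o u)) => [|x|y] /=; [|by rewrite ua|by rewrite ub].
  by rewrite -(vE (hom_of_morph idM)).
by rewrite -fu -fE; exists (u g).
Qed.

Definition letter := (A + B)%type.

Definition letter_val (l : letter) : G :=
  match l with inl x => a x | inr y => b y end.

Definition word_val (w : seq letter) : G :=
  foldr (fun l g => letter_val l * g) 1 w.

(* [true] announces a letter from A, [false] one from B. *)
Fixpoint alternating (PA : A -> Prop) (PB : B -> Prop) (s : bool)
    (w : seq letter) : Prop :=
  match w with
  | [::] => True
  | inl x :: w' => [/\ s, PA x & alternating PA PB false w']
  | inr y :: w' => [/\ ~~ s, PB y & alternating PA PB true w']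
  end.

Lemma alternating_sub (PA PA' : A -> Prop) (PB PB' : B -> Prop) s w :
    (forall x, PA x -> PA' x) -> (forall y, PB y -> PB' y) ->
  alternating PA PB s w -> alternating PA' PB' s w.
Proof.
by move=> sA sB; elim: w s => // -[x|y] w IH s [? ? ?]; split; auto.
Qed.

Let reduced := alternating (fun x => ~ range i x) (fun y => ~ range j y).

Let almost (g : G) := exists h s w, reduced s w /\ g = a (i h) * word_val w.

Let almost_a x g : almost g -> almost (a x * g).
Proof.
move=> [h [s [w [rw ->]]]]; rewrite mulgA -gmulfM.
have nonhead x' w' : reduced false w' -> almost (a x' * word_val w').
  move=> rw'; have [[k _ <-]|nx'] := EM (range i x'); first by exists k, false, w'.
  by exists 1, true, (inl x' :: w'); rewrite !gmulf1 mul1g.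
case: w rw => [|[x1|y1] w] rw; first exact: nonhead.
  by rewrite /= mulgA -gmulfM; apply: nonhead; case: rw.
by apply: nonhead; case: rw => sf *; split.
Qed.

Let almost_b y g : almost g -> almost (b y * g).
Proof.
have [_ _ abH _] := hG.
move=> [h [s [w [rw ->]]]]; rewrite abH mulgA -gmulfM.
have nonhead y' w' : reduced true w' -> almost (b y' * word_val w').
  move=> rw'; have [[k _ <-]|ny'] := EM (range j y').
    by exists k, true, w'; rewrite abH.
  by exists 1, false, (inr y' :: w'); rewrite !gmulf1 mul1g.
case: w rw => [|[x1|y1] w] rw; first exact: nonhead.
  by apply: nonhead; case: rw => sf *; split.
by rewrite /= mulgA -gmulfM; apply: nonhead; case: rw.
Qed.

Lemma reduced_form g : (exists h, g = a (i h)) \/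
  exists s w, [/\ reduced s w, w <> [::] & g = word_val w].
Proof.
have [_ _ abH _] := hG.
have [h [s [w [rw gE]]]] : almost g.
  (* The equivalence, rather than one implication, is what makes S closed under division. *)
  pose S : set G := [set g | forall g', almost g' <-> almost (g * g')].
  have sS : subgroup S.
    split=> [g'|x y Sx Sy g']; first by rewrite mul1g.
    by rewrite -mulgA -(Sx (y^-1 * g')) (Sy (y^-1 * g')) mulVKg.
  have Sa x : S (a x).
    move=> g'; split=> [|/(almost_a x^-1)]; first exact: almost_a.
    by rewrite gmulfV mulKg.
  have Sb y : S (b y).
    move=> g'; split=> [|/(almost_b y^-1)]; first exact: almost_b.
    by rewrite gmulfV mulKg.
  have /= Sg := amalgam_ind sS Sa Sb g; rewrite -(mulg1 g); apply: (Sg 1).1.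
  by exists 1, true, [::]; rewrite !gmulf1 mulg1.
case: w rw gE => [|[x1|y1] w] rw gE; first by left; exists h; rewrite gE mulg1.
  right; exists true, (inl (i h * x1) :: w); split=> //.
    case: rw => _ nx rw; split=> //; apply: contra_not nx => ix.
    exact: subgroupMl (range_subgroup i) _ ix.
  by rewrite gE /= gmulfM mulgA.
right; exists false, (inr (j h * y1) :: w); split=> //.
  case: rw => _ ny rw; split=> //; apply: contra_not ny => jy.
  exact: subgroupMl (range_subgroup j) _ jy.
by rewrite gE /= abH gmulfM mulgA.
Qed.

Section WreathHom.
Variables (Q : finGroupType) (psiA : hom A Q) (psiB : hom B Q).
Hypothesis psiH : forall h, psiA (i h) = psiB (j h).

Definition coset_function (R : Type) (r : Q -> R) :=
  forall q h, r (q * psiA (i h)) = r q.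

Definition twisted_hom (R : groupType) (r : Q -> R) (phi : hom G (wreath R Q)) :=
  (forall x, phi (a x) = ([ffun=> 1], psiA x)) /\
  (forall y, phi (b y) = ([ffun q => r q / r (q * psiB y)], psiB y)).

Lemma exists_twisted_hom (R : groupType) (r : Q -> R) : coset_function r ->
  exists phi, twisted_hom r phi.
Proof.
move=> rC; have [_ _ abH univ] := hG.
have [|phiA phiAE] := @wreath_hom R Q A psiA (fun _ _ => 1).
  by move=> *; rewrite mulg1.
have [|phiB phiBE] := @wreath_hom R Q B psiB (fun y q => r q / r (q * psiB y)).
  by move=> x y q; rewrite gmulfM !mulgA mulgVK.
have [|phi [[phia phib] _]] := univ _ phiA phiB.
  move=> h; rewrite phiAE phiBE psiH; congr (_, _); apply/ffunP=> q.
  by rewrite !ffunE -psiH rC mulgV.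
by exists phi; split=> [x|y]; rewrite ?phia ?phib.
Qed.

Lemma exists_amalgam_hom : exists psi : hom G Q,
  (forall x, psi (a x) = psiA x) /\ (forall y, psi (b y) = psiB y).
Proof.
by have [_ _ _ univ] := hG; have [psi [psiE _]] := univ _ _ _ psiH; exists psi.
Qed.

(** A letter of A only moves the current point. A letter of B contributes both values of r in its
    base component, so the points come in pairs and the signs alternate. *)
Fixpoint word_points (q : Q) (w : seq letter) : seq Q :=
  match w with
  | [::] => [::]
  | inl x :: w' => word_points (q * psiA x) w'
  | inr y :: w' => [:: q, q * psiB y & word_points (q * psiB y) w']
  end.

Lemma twisted_hom_word (R : groupType) (r : Q -> R) phi w q : twisted_hom r phi ->
  (phi (word_val w)).1 q = alt_word r false (word_points q w).
Proof.
move=> [phia phib]; elim: w q => [|[x|y] w IH] q /=.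
- by rewrite gmulf1 wreath_oneE1.
- by rewrite gmulfM wreath_mulE1 phia /= ffunE mul1g IH.
by rewrite gmulfM wreath_mulE1 phib /= ffunE IH mulgA.
Qed.

(** Consecutive points lie in different cosets of psi(H). An initial letter of A leaves the coset of
    q before the first point, whereas an initial letter of B has q itself as first point; hence the
    separate predecessor e in the second half. *)
Lemma word_points_path (rho : Q -> Q) w :
    (forall q q', rho q = rho q' -> range (psiA \o i) (q^-1 * q')) ->
  let PA x := ~ range (psiA \o i) (psiA x) in
  let PB y := ~ range (psiB \o j) (psiB y) in
  forall q,
  (alternating PA PB true w ->
     path (fun x y => x != y) (rho q) (map rho (word_points q w))) /\
  (alternating PA PB false w -> forall e, e != rho q ->
     path (fun x y => x != y) e (map rho (word_points q w))).
Proof.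
move=> rhoP PA PB; elim: w => [|[x|y] w IH] q //.
  split=> [[_ Px Aw]|[]] //=; apply: (IH _).2 => //.
  by apply/eqP => /rhoP; rewrite mulKg.
split=> [[]|[_ Py Aw] e eq] //=; rewrite eq /=; apply/andP; split.
  apply/eqP => /rhoP; rewrite mulKg => -[h _ /= hy]; apply: Py; exists h => //=.
  by rewrite -psiH.
exact: (IH _).1.
Qed.

Lemma word_survives (p : nat) s w : prime p -> w <> [::] ->
    alternating (fun x => ~ range (psiA \o i) (psiA x))
      (fun y => ~ range (psiB \o j) (psiB y)) s w ->
  exists (R : finGroupType) (r : Q -> R), [/\ p.-nat #|{: R}|, coset_function r &
    forall phi, twisted_hom r phi -> phi (word_val w) <> 1].
Proof.
move=> p_pr w0 Aw.
have [rho [rhoP rhoM]] := coset_repr (range_subgroup (psiA \o i)).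
have rhoI q q' : rho q = rho q' -> range (psiA \o i) (q^-1 * q').
  move=> e; have sR := range_subgroup (psiA \o i).
  have -> : q^-1 * q' = q^-1 * rho q / (q'^-1 * rho q').
    by rewrite e invgM invgK mulgA mulgK.
  exact: sR.2.
pose pts := map rho (word_points 1 w).
have adj k : (k.+1 < size pts)%N -> nth 1 pts k <> nth 1 pts k.+1.
  move=> lt_k; suff /(sortedP 1)/(_ k lt_k)/eqP : sorted (fun x y => x != y) pts by [].
  have [P1 P2] := word_points_path w rhoI 1.
  case: s Aw => [/P1/path_sorted//|Aw].
  rewrite /pts; case: w w0 Aw {P1 P2 lt_k pts} => // -[x|y] w _ [] // _ Py Aw.
  have [P1 _] := word_points_path w rhoI (1 * psiB y).
  rewrite /=; apply/andP; split; last exact: P1.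
  apply/eqP => /rhoI; rewrite mulKg => -[h _ /= hy]; apply: Py; exists h => //=.
  by rewrite -psiH.
have [R [r0 [pR r0P]]] := alternating_word_separated p_pr adj.
exists R, (r0 \o rho); split=> // [q h|phi phiP phi1]; first by rewrite /= rhoM //; exists h.
have : alt_word (r0 \o rho) false (word_points 1 w) = 1.
  by rewrite -(twisted_hom_word _ _ phiP) phi1 wreath_oneE1.
have -> b' l : alt_word (r0 \o rho) b' l = alt_word r0 b' (map rho l).
  by elim: l b' => //= x l IH b'; rewrite IH.
rewrite -/pts -{1}(mkseq_nth 1 pts) alt_word_mkseq => pts1.
(* The empty prefix and the full one have the same value, so there are no points at all. The word is
   then a single letter of A, and the top component detects it. *)
have pts0 : size pts = 0 by apply: (r0P (size pts) 0).
have wE : word_points 1 w = [::].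
  by apply/size0nil; rewrite -pts0 size_map.
clear pts adj r0P pts1 pts0.
case: w w0 Aw wE phi1 => // -[x|y] // w _ [_ Px Aw] wE phi1.
case: w Aw wE phi1 => [|[x'|y'] w] [] // _ phi1; apply: Px.
move: (congr1 (fun u => u.2) phi1); rewrite /= mulg1 phiP.1 /= => ->.
by exists 1; rewrite /= ?gmulf1.
Qed.

End WreathHom.

End AmalgamWords.

(** * Separating the letters of a word in finite nilpotent quotients *)

Definition nilpotent_fin (P : nat_pred) (Q : finGroupType) :=
  nilpotent [set: Q]%G /\ P.-nat #|{: Q}|.

Lemma nilpotent_fin_group P (Q : finGroupType) :
  nilpotent_fin P Q -> finite_nilpotent_P_group P Q.
Proof.
by move=> [nQ PQ]; split; [apply: finite_P_group_fin | apply: nilpotent_group_fin].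
Qed.

Lemma nilpotent_fin_p (P : nat_pred) (p : nat) (Q : finGroupType) :
  p \in P -> p.-nat #|{: Q}| -> nilpotent_fin P Q.
Proof.
move=> pP pQ; split; first by apply: (@pgroup_nil _ p); apply: pgroupT.
by apply: sub_in_pnat pQ => q _; rewrite inE => /eqP->.
Qed.

Lemma nilpotent_fin_prod P (Q R : finGroupType) :
  nilpotent_fin P Q -> nilpotent_fin P R -> nilpotent_fin P (Q * R)%type.
Proof.
move=> [nQ PQ] [nR PR]; split; last by rewrite card_prod pnatM PQ PR.
have -> : [set: Q * R]%G = setX_group [set: Q]%G [set: R]%G.
  by apply/val_inj/setP => x; rewrite !inE.
rewrite /= (dprod_nil (setX_dprod [set: Q]%G [set: R]%G)).
by rewrite -(isog_nil (isog_setX1 R _)) -(isog_nil (isog_set1X Q _)) nQ nR.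
Qed.

Lemma nilpotent_fin_subg P (Q : finGroupType) (D : {group Q}) :
  nilpotent_fin P Q -> nilpotent_fin P (subg_of D).
Proof.
move=> [nQ PQ]; split.
  by rewrite (isog_nil (isog_symr (isog_subg D))); apply: nilpotentS nQ; apply: finset.subsetT.
rewrite card_subg_of; apply: pnat_dvd PQ; rewrite -cardsT.
by apply: cardSg; apply: finset.subsetT.
Qed.

Section Separation.
Variables (A B H : groupType) (i : hom H A) (j : hom H B).

Lemma separates_meet C (N N' : set A) (M M' : set B) :
    (forall Q R : finGroupType, C Q -> C R -> C (Q * R)%type) ->
    separates i j C N M -> separates i j C N' M' ->
  separates i j C (N `&` N') (M `&` M').
Proof.
move=> Cprod [Q [fA [fB [CQ fH kA kB]]]] [R [gA [gB [CR gH lA lB]]]].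
have pairM (X : groupType) (f : hom X Q) (g : hom X R) :
    {morph (fun x => (f x, g x) : Q * R) : x y / x * y}.
  by move=> x y; rewrite !gmulfM.
exists (Q * R)%type, (hom_of_morph (pairM A fA gA)), (hom_of_morph (pairM B fB gB)).
split=> [|h|x|y]; first exact: Cprod.
- by rewrite /= fH gH.
- by move=> [fx gx]; split; [apply: kA | apply: lA].
by move=> [fy gy]; split; [apply: kB | apply: lB].
Qed.

Definition letter_separated (C : finGroupType -> Prop) (x : A) :=
  exists (Q : finGroupType) (psiA : hom A Q) (psiB : hom B Q),
    [/\ C Q, forall h, psiA (i h) = psiB (j h) &
        ~ range (psiA \o i) (psiA x)].

Lemma separates_letter C (Z : groupType) (s : hom A Z) (M : set B) x :
  separates i j C (kernel s) M -> ~ (s @` range i) (s x) -> letter_separated C x.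
Proof.
move=> [Q [psiA [psiB [CQ psiH kA _]]]] nsx; exists Q, psiA, psiB; split=> //.
move=> [h _ /= hx]; apply: nsx; exists (i h); first by exists h.
have : kernel s (i h / x) by apply: kA; rewrite /kernel /= gmulfF hx mulgV.
by rewrite /kernel /= gmulfF => /divg1_eq.
Qed.
End Separation.

Section GoodWords.
Variables (A B H : groupType) (i : hom H A) (j : hom H B).
Variable C : finGroupType -> Prop.
Hypothesis Cprod : forall Q R : finGroupType, C Q -> C R -> C (Q * R)%type.

Definition coset_separating s (w : seq (A + B)) (Q : finGroupType)
    (psiA : hom A Q) (psiB : hom B Q) :=
  alternating (fun x => ~ range (psiA \o i) (psiA x))
    (fun y => ~ range (psiB \o j) (psiB y)) s w.

(** In a product of compatible pairs a letter stays outside the image of H as soon as one factor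
    keeps it outside, so letters can be treated one by one. *)
Lemma exists_coset_separating (Q0 : finGroupType) : C Q0 ->
    (forall x, ~ range i x -> letter_separated i j C x) ->
    (forall y, ~ range j y -> letter_separated j i C y) ->
  forall s w, alternating (fun x => ~ range i x) (fun y => ~ range j y) s w ->
  exists (Q : finGroupType) (psiA : hom A Q) (psiB : hom B Q),
    [/\ C Q, forall h, psiA (i h) = psiB (j h) & coset_separating s w psiA psiB].
Proof.
move=> CQ0 sepA sepB s w; elim: w s => [|l w IH] s.
  by move=> _; exists Q0, (hom_of_morph (@trivial_hom A Q0)), (hom_of_morph (@trivial_hom B Q0)); split.
have pairM (X : groupType) (Q R : finGroupType) (f : hom X Q) (g : hom X R) :
    {morph (fun x => (f x, g x) : Q * R) : x y / x * y}.
  by move=> x y; rewrite !gmulfM.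
have combine s' (Q R : finGroupType) (fA : hom A Q) (fB : hom B Q) (gA : hom A R)
    (gB : hom B R) : C Q -> C R -> (forall h, fA (i h) = fB (j h)) ->
    (forall h, gA (i h) = gB (j h)) -> coset_separating s' w gA gB ->
    exists (T : finGroupType) (tA : hom A T) (tB : hom B T),
      [/\ C T, forall h, tA (i h) = tB (j h), coset_separating s' w tA tB,
        forall x, range (tA \o i) (tA x) -> range (fA \o i) (fA x) &
        forall y, range (tB \o j) (tB y) -> range (fB \o j) (fB y)].
  move=> CQ CR fH gH gw.
  exists (Q * R)%type, (hom_of_morph (pairM A Q R fA gA)), (hom_of_morph (pairM B Q R fB gB)).
  split=> [|h||x|y]; first exact: Cprod.
  - by rewrite /= fH gH.
  - by apply: alternating_sub gw => x nx [h _ /=] [_ e]; apply: nx; exists h.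
  - by move=> [h _ /=] [e _]; exists h.
  by move=> [h _ /=] [e _]; exists h.
case: l => [x|y] /= [sl nl rw]; have [R [gA [gB [CR gH gw]]]] := IH _ rw.
  have [Q [fA [fB [CQ fH nx]]]] := sepA x nl.
  have [T [tA [tB [CT tH tw tx _]]]] := combine _ _ _ _ _ _ _ CQ CR fH gH gw.
  by exists T, tA, tB; split=> //; split=> // /tx.
have [Q [fB [fA [CQ fH ny]]]] := sepB y nl.
have [T [tA [tB [CT tH tw _ ty]]]] := combine _ _ _ fA fB _ _ CQ CR (fun h => esym (fH h)) gH gw.
by exists T, tA, tB; split=> //; split=> // /ty.
Qed.
End GoodWords.

Section Residual.
Variables (P : nat_pred) (A B H : groupType) (i : hom H A) (j : hom H B).
Hypothesis P_prime : {subset P <= prime}.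
Hypothesis sepP : forall (p : nat) (QA QB : finGroupType) (al0 : hom A QA) (be0 : hom B QB),
  p \in P -> p.-nat #|{: QA}| -> p.-nat #|{: QB}| ->
  separates_p i j p (kernel al0) (kernel be0).

Lemma trivial_p_nat (p : nat) : p.-nat #|{: 'I_1}|.
Proof. by rewrite card_ord. Qed.

Lemma separates_p_left (p : nat) (QA : finGroupType) (al0 : hom A QA) : p \in P ->
  p.-nat #|{: QA}| -> separates_p i j p (kernel al0) [set: B].
Proof.
move=> pP pQ; apply: separates_sub (sepP al0 (hom_of_morph (@trivial_hom B 'I_1)) pP pQ _) => //.
exact: trivial_p_nat.
Qed.

(** The elements of Z are excluded from the image of the kernel one at a time, each with a prime of
    its own. Here different primes come together: finite p-groups multiply to a nilpotent group. *)
Lemma separates_nilpotent_left (Z : groupType) (s : hom A Z) (p0 : nat) :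
    p0 \in P -> finite_nilpotent_P_group P Z ->
  separates i j (nilpotent_fin P) (kernel s) [set: B].
Proof.
move=> p0P ZP; have [[/finite_seqP[l lE] _] _] := ZP.
suff sep : separates i j (nilpotent_fin P)
    [set x | s x \in l -> s x = 1] [set: B].
  apply: separates_sub sep => // x /=; apply.
  by have : [set: Z] (s x) by []; rewrite lE.
elim: l {lE} => [|z l IH].
  exists 'I_1, (hom_of_morph (@trivial_hom A 'I_1)), (hom_of_morph (@trivial_hom B 'I_1)).
  by split=> //; apply: (nilpotent_fin_p p0P); apply: trivial_p_nat.
have [z1|z1] := EM (z = 1).
  apply: separates_sub IH => // x /= xl; rewrite inE => /orP[/eqP->|]; first by [].
  exact: xl.
have [p [Q [f [pP pQ fz]]]] := nilpotent_P_group_residually_p P_prime ZP z1.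
have [R [psiA [psiB [pR psiH kA kB]]]] := separates_p_left (f \o s) pP pQ.
have sepz : separates i j (nilpotent_fin P) (kernel (f \o s)) [set: B].
  by exists R, psiA, psiB; split=> //; apply: nilpotent_fin_p pP pR.
apply: separates_sub (separates_meet (@nilpotent_fin_prod P) IH sepz) => //.
move=> x [/= xl fsx]; rewrite inE => /orP[/eqP sx|]; last exact: xl.
by case: fz; rewrite -sx.
Qed.

Lemma residually_p_coset_separating (p : nat) : p \in P ->
    separable (finite_P_group p) (range i) ->
  forall x, ~ range i x ->
  letter_separated i j (fun Q : finGroupType => p.-nat #|{: Q}|) x.
Proof.
move=> pP sep x nx; have [Z [s [ZP ss sx]]] := sep x nx.
have [Q [f [pQ fb]]] := finite_P_groupP ZP.
have [g fK _] := fb; apply: (separates_letter (s := f \o s) (M := [set: B])).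
  exact: separates_p_left.
by move=> [y iy /(can_inj fK) e]; apply: sx; exists y.
Qed.

Lemma residually_nilpotent_coset_separating (p0 : nat) : p0 \in P ->
    separable (finite_nilpotent_P_group P) (range i) ->
  forall x, ~ range i x -> letter_separated i j (nilpotent_fin P) x.
Proof.
move=> p0P sep x nx; have [Z [s [ZP ss sx]]] := sep x nx.
exact: (separates_letter (separates_nilpotent_left s p0P ZP)).
Qed.

Lemma residually_nilpotent_on_H (p0 : nat) h : p0 \in P ->
    residually (finite_nilpotent_P_group P) A -> injective i -> h <> 1 ->
  exists (Q : finGroupType) (psiA : hom A Q) (psiB : hom B Q),
    [/\ nilpotent_fin P Q, forall h, psiA (i h) = psiB (j h) & psiA (i h) <> 1].
Proof.
move=> p0P resA i_inj h1.
have [|Z [s [ZP _ sh]]] := resA (i h).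
  by move=> ih1; apply: h1; apply: i_inj; rewrite ih1 gmulf1.
have [Q [psiA [psiB [QP psiH kA _]]]] := separates_nilpotent_left s p0P ZP.
by exists Q, psiA, psiB; split=> // /kA.
Qed.

End Residual.

Section ResidualG.
Variables (P : nat_pred) (G : groupType).

Lemma residual_image (Q : finGroupType) (f : hom G Q) g :
    nilpotent_fin P Q -> f g <> 1 ->
  exists (Y : groupType) (s : hom G Y),
    [/\ finite_nilpotent_P_group P Y, surjective s & s g <> 1].
Proof.
move=> QP fg; have [D [f' [fs fE]]] := hom_image f; exists (subg_of D), f'; split=> //.
  by apply: nilpotent_fin_group; apply: nilpotent_fin_subg.
by move=> fg1; apply: fg; rewrite -fE fg1.
Qed.

(* N is the intersection of the image of G with the base group. *)
Lemma wreath_image_extension (p : nat) (Q R : finGroupType)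
    (phi : hom G (wreath R Q)) g :
    prime p -> p.-nat #|{: R}| -> nilpotent_fin P Q -> phi g <> 1 ->
  exists (X : finGroupType) (s : hom G X) (N Q' : finGroupType) (f : hom N X) (h : hom X Q'),
    [/\ surjective s, s g <> 1, p.-nat #|{: N}|, nilpotent_fin P Q' &
     [/\ injective f, surjective h, range f = kernel h &
         (p \in P -> P.-nat #|{: X}|)]].
Proof.
move=> p_pr pR QP phig; have [D [s [ss sE]]] := hom_image phi.
have projM : {morph (fun x : subg_of D => (sgval x).2) : x y / x * y} by [].
have [D' [h [hs hE]]] := hom_image (hom_of_morph projM).
pose K := [set x : subg_of D | h x == 1]%SET.
have gK : group_set K.
  apply/group_setP; split; first by rewrite inE gmulf1.
  by move=> x y; rewrite !inE => /eqP hx /eqP hy; rewrite gmulfM hx hy mulg1.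
have valM : {morph (fun x : subg_of (Group gK) => sgval x) : x y / x * y} by [].
exists (subg_of D), s, (subg_of (Group gK)), (subg_of D'), (hom_of_morph valM), h.
split=> //.
- by move=> sg1; apply: phig; rewrite -sE sg1.
(* Elements of N have trivial top component, so their powers are taken coordinatewise and the
   exponent of R applies. *)
- apply: p_nat_of_exponent => // x; have [k kR] := p_nat_exponent pR; exists k.
  apply/val_inj/val_inj; set u := \val (\val x).
  have u2 : u.2 = 1.
    have := subgP x; rewrite inE => /eqP hx.
    by rewrite -[u.2]/(hom_of_morph projM (sgval x)) -hE hx.
  have -> : \val (\val (x ^+ (p ^ k))) = u ^+ (p ^ k).
    rewrite -[\val (x ^+ _)]/(hom_of_morph valM (x ^+ (p ^ k))) gmulfXn.
    have valDM : {morph (fun y : subg_of D => sgval y) : x y / x * y} by [].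
    rewrite -[LHS]/(hom_of_morph valDM (hom_of_morph valM x ^+ (p ^ k))) gmulfXn.
    by [].
  have uX n : (u ^+ n).2 = 1 /\ forall q, (u ^+ n).1 q = u.1 q ^+ n.
    elim: n => [|n [IH2 IH1]]; first by split=> [|q]; rewrite ?wreath_oneE1.
    rewrite expgSr wreath_mulE2 IH2 u2 mulg1; split=> // q.
    by rewrite wreath_mulE1 IH1 IH2 mulg1 expgSr.
  by apply: wreathP => [q|]; rewrite ?(uX _).1 // (uX _).2 kR wreath_oneE1.
- exact: nilpotent_fin_subg.
split=> //; first exact: subg_inj.
  apply/seteqP; split=> [_ [x _ <-]|x hx].
    by have := subgP x; rewrite inE => /eqP.
  have xK : x \in Group gK by rewrite inE; apply/eqP.
  by exists (Subg xK).
move=> pP; rewrite card_subg_of; apply: (@pnat_dvd _ #|{: wreath R Q}|).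
  by rewrite -cardsT; apply: cardSg; apply: finset.subsetT.
rewrite card_wreath pnatM pnatX QP.2 andbT; apply/orP; left.
by have [] := nilpotent_fin_p pP pR.
Qed.

End ResidualG.

(** * Freeness of the kernel *)

Section FreeKernel.
Variables (A B H X : groupType) (Q : finGroupType).
Variables (i : hom H A) (j : hom H B) (a : hom A X) (b : hom B X) (psi : hom X Q).
Hypothesis abH : forall h, a (i h) = b (j h).
Hypothesis X_gen : forall S : set X, subgroup S ->
  (forall x, S (a x)) -> (forall y, S (b y)) -> forall g, S g.

Definition half_invariant (K : Type) (r : Q -> K) :=
  forall q h, r (q * psi (a (i h))) = r q.

Definition twists (K : groupType) (r : Q -> K) (phi : hom X (wreath K Q)) :=
  [/\ forall x q, (phi (a x)).1 q = 1,
      forall y q, (phi (b y)).1 q = r q / r (q * psi (b y)) &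
      forall g, (phi g).2 = psi g].

Hypothesis X_twist : forall (K : groupType) (r : Q -> K), half_invariant r ->
  exists phi, twists r phi.
Hypothesis X_faithful : forall g, (forall (K : groupType) (r : Q -> K) phi,
  half_invariant r -> twists r phi -> phi g = 1) -> g = 1.

(** Thus [psi] embeds the vertex group a(A), as it does b(B) below; the kernel of [psi] meets no
    conjugate of them, which is the source of its freeness. *)
Lemma half_kernel_a x : psi (a x) = 1 -> a x = 1.
Proof.
move=> px; apply: X_faithful => K r phi rC [phia _ phi2].
by apply: wreathP => [q|]; rewrite ?phia ?wreath_oneE1 // phi2.
Qed.

Lemma half_kernel_b y : psi (b y) = 1 -> b y = 1.
Proof.
move=> py; apply: X_faithful => K r phi rC [_ phib phi2].
by apply: wreathP => [q|]; rewrite ?phib ?wreath_oneE1 ?phi2 // py mulg1 mulgV.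
Qed.

Lemma twists_mul (K : groupType) (r : Q -> K) phi g g' : twists r phi ->
  (phi (g * g')).1 1 = (phi g).1 1 * (phi g').1 (psi g).
Proof. by case=> _ _ phi2; rewrite gmulfM wreath_mulE1 mul1g phi2. Qed.

(** S is a union of cosets of psi(c Y), that is, a set of vertices of one kind; equivariance leaves
    one value of [s] to be chosen per vertex. *)
Definition section_over (Y : groupType) (c : hom Y X) (S : {set Q}) (s : Q -> X) :=
  [/\ forall q y, q \in S -> q * psi (c y) \in S,
      forall q, q \in S -> psi (s q) = q &
      forall q y, q \in S -> s q * c y = s (q * psi (c y))].

Lemma extend_section (Y : groupType) (c : hom Y X) (S : {set Q}) (s : Q -> X) q0 g0 :
    (forall y, psi (c y) = 1 -> c y = 1) ->
    section_over c S s -> q0 \notin S -> psi g0 = q0 ->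
  exists (S' : {set Q}) (s' : Q -> X),
    [/\ section_over c S' s', S \proper S', forall q, q \in S -> s' q = s q,
        q0 \in S' & (forall y, s' (q0 * psi (c y)) = g0 * c y) /\
        (forall q, q \in S' -> q \in S \/ exists y, q = q0 * psi (c y))].
Proof.
move=> cK [Sc sE sM] q0S g0E.
pose orb q := exists y, q = q0 * psi (c y).
have orbS y : q0 * psi (c y) \notin S.
  apply: contra q0S => /(Sc _ y^-1).
  by rewrite !gmulfV mulgK.
have /choice[t tE] q : exists y, orb q -> q = q0 * psi (c y).
  by have [[y ->]|no] := EM (orb q); [exists y | exists 1].
pose s' q := if q \in S then s q else g0 * c (t q).
(* Injectivity of [psi] on c(Y) makes the value on the new coset independent of the chosen y. *)
have cinj y y' : psi (c y) = psi (c y') -> c y = c y'.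
  by move=> e; apply/divg1_eq; rewrite -gmulfF; apply: cK; rewrite !gmulfF e mulgV.
have s'E y : s' (q0 * psi (c y)) = g0 * c y.
  rewrite /s' (negbTE (orbS y)); congr (_ * _); apply: cinj.
  by apply: (mulgI q0); rewrite -(tE (q0 * psi (c y))) //; exists y.
pose S' := [set q : Q | (q \in S) || `[< orb q >]]%SET.
have S'P q : q \in S' <-> q \in S \/ orb q.
  by rewrite inE; split=> [/orP[|/asboolW]|[->|/asboolT->]]; rewrite ?orbT; auto.
have q0S' : q0 \in S' by apply/S'P; right; exists 1; rewrite !gmulf1 mulg1.
exists S', s'; split=> //; last by split=> // q /S'P.
- split=> [q y /S'P[qS|[y' ->]]|q /S'P[qS|[y' ->]]|q y /S'P[qS|[y' ->]]].
  + by apply/S'P; left; apply: Sc.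
  + by apply/S'P; right; exists (y' * y); rewrite !gmulfM mulgA.
  + by rewrite /s' qS sE.
  + by rewrite s'E gmulfM g0E.
  + by rewrite /s' qS Sc // sM.
  + by rewrite s'E -!mulgA -!gmulfM s'E.
- by apply/properP; split; [apply/fintype.subsetP => q qS; apply/S'P; left | exists q0].
by move=> q qS; rewrite /s' qS.
Qed.

(* A subtree of the graph with vertices Q / psi(A) and Q / psi(B) and edges
   Q / psi(H): [SA] and [SB] are the vertices reached, [T] the tree edges, and
   the sections multiply out the tree paths from the base vertex psi(A). *)
Definition tree_state (SA SB T : {set Q}) (sA sB : Q -> X) :=
  [/\ section_over a SA sA, section_over b SB sB, 1 \in SA /\ sA 1 = 1,
      forall q h, q \in T -> q * psi (a (i h)) \in T &
      [/\ forall q, q \in T -> [/\ q \in SA, q \in SB & sA q = sB q] &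
      forall (K : groupType) (r : Q -> K) phi, half_invariant r -> twists r phi ->
        (forall q, q \in T -> r q = 1) ->
        (forall q, q \in SA -> (phi (sA q)).1 1 = 1) /\
        (forall q, q \in SB -> (phi (sB q)).1 1 = (r q)^-1)]].

Lemma exists_tree_state : exists SA sA, tree_state SA finset.set0 finset.set0 sA (fun=> 1).
Proof.
have s0 : section_over a finset.set0 (fun=> 1) by split=> [q y|q|q y]; rewrite finset.in_set0.
have [||S [s [sS _ _ S1 [sE SE]]]] :=
  @extend_section A a finset.set0 (fun=> 1) 1 1 half_kernel_a s0.
- by rewrite finset.in_set0.
- by rewrite gmulf1.
exists S, s; split=> //.
- by split=> [q y|q|q y]; rewrite finset.in_set0.
- by split=> //; have := sE 1; rewrite !gmulf1 !mulg1.
- by move=> q h; rewrite finset.in_set0.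
split=> [q|K r phi _ tw _]; first by rewrite finset.in_set0.
split=> q; last by rewrite finset.in_set0.
move=> /SE[|[x ->]]; first by rewrite finset.in_set0.
by rewrite sE mul1g; case: tw.
Qed.

Lemma edge_orbit (T : {set Q}) q0 :
    (forall q h, q \in T -> q * psi (a (i h)) \in T) ->
  exists T' : {set Q}, [/\ T \subset T', q0 \in T',
    forall q h, q \in T' -> q * psi (a (i h)) \in T' &
    forall q, q \in T' -> q \in T \/ exists h, q = q0 * psi (a (i h))].
Proof.
move=> Tc; pose orb q := exists h, q = q0 * psi (a (i h)).
pose T' := [set q : Q | (q \in T) || `[< orb q >]]%SET.
have T'P q : q \in T' <-> q \in T \/ orb q.
  by rewrite inE; split=> [/orP[|/asboolW]|[->|/asboolT->]]; rewrite ?orbT; auto.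
exists T'; split=> [|||q /T'P//].
- by apply/fintype.subsetP => q qT; apply/T'P; left.
- by apply/T'P; right; exists 1; rewrite !gmulf1 mulg1.
move=> q h /T'P[qT|[k ->]]; apply/T'P; first by left; apply: Tc.
by right; exists (k * h); rewrite !gmulfM mulgA.
Qed.

(** The new vertex is reached along the edge of q0, which joins the tree. Since r is 1 on that edge,
    the factor r(q0) / r(q) contributed by a letter of B reduces to the inverse of r(q). *)
Lemma grow_tree_B SA SB T sA sB q0 : tree_state SA SB T sA sB ->
    q0 \in SA -> q0 \notin SB ->
  exists (SB' T' : {set Q}) sB', SB \proper SB' /\ tree_state SA SB' T' sA sB'.
Proof.
move=> [hA hB h1 Tc [TS Tr]] q0A q0B; have [cA pA mA] := hA.
have [S' [s' [hS' SS' s'S q0S' [s'E S'E]]]] := extend_section half_kernel_b hB q0B (pA _ q0A).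
have [T' [TT' q0T' T'c T'E]] := edge_orbit q0 Tc.
exists S', T', s'; split=> //; split=> //; split=> [q /T'E[qT|[h ->]]|K r phi rC tw r1].
- have [qA qB e] := TS q qT; split=> //; last by rewrite s'S.
  exact: (fintype.subsetP (proper_sub SS')).
- split; [exact: cA | by rewrite abH; case: hS' => S'c _ _; apply: S'c |].
  by rewrite -mA // abH s'E.
have [rA rB] := Tr K r phi rC tw (fun q qT => r1 q (fintype.subsetP TT' q qT)).
split=> // q /S'E[qB|[y ->]]; first by rewrite s'S // rB.
rewrite s'E (twists_mul _ _ tw) rA // mul1g pA //.
by case: (tw) => _ -> _; rewrite (r1 _ q0T') mul1g.
Qed.

Lemma grow_tree_A SA SB T sA sB q0 : tree_state SA SB T sA sB ->
    q0 \in SB -> q0 \notin SA ->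
  exists (SA' T' : {set Q}) sA', SA \proper SA' /\ tree_state SA' SB T' sA' sB.
Proof.
move=> [hA hB [h1 h1'] Tc [TS Tr]] q0B q0A; have [cB pB mB] := hB.
have [S' [s' [hS' SS' s'S q0S' [s'E S'E]]]] := extend_section half_kernel_a hA q0A (pB _ q0B).
have [T' [TT' q0T' T'c T'E]] := edge_orbit q0 Tc.
have sS := fintype.subsetP (proper_sub SS').
exists S', T', s'; split=> //; split=> //; first by split; [apply: sS | rewrite s'S].
split=> [q /T'E[qT|[h ->]]|K r phi rC tw r1].
- by have [qA qB e] := TS q qT; split=> //; [apply: sS | rewrite s'S].
- split; [by case: hS' => S'c _ _; apply: S'c | by rewrite abH; apply: cB |].
  by rewrite s'E abH -mB.
have [rA rB] := Tr K r phi rC tw (fun q qT => r1 q (fintype.subsetP TT' q qT)).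
split=> // q /S'E[qA|[y ->]]; first by rewrite s'S // rA.
rewrite s'E (twists_mul _ _ tw) rB // (r1 _ q0T') invg1 mul1g.
by case: tw.
Qed.

(** Equality of the two sets means that no edge leaves the reached vertices: an edge q has its ends
    in the tree exactly when q is in SA, respectively in SB. *)
Lemma exists_spanning_tree : exists S T sA sB, tree_state S S T sA sB.
Proof.
have [SA0 [sA0 st0]] := exists_tree_state.
have grow n (SA SB T : {set Q}) sA sB : (#|{: Q}| + #|{: Q}| <= n + (#|SA| + #|SB|))%N ->
    tree_state SA SB T sA sB -> exists S T sA sB, tree_state S S T sA sB.
  elim: n SA SB T sA sB => [|n IH] SA SB T sA sB le_n st; last first.
    have [sAB|/subsetPn[q0 q0A q0B]] := boolP (SA \subset SB); last first.
      have [SB' [T' [sB' [lt st']]]] := grow_tree_B st q0A q0B.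
      apply: IH st'; apply: leq_trans le_n _.
      by rewrite addSnnS leq_add2l -addnS leq_add2l proper_card.
    have [sBA|/subsetPn[q0 q0B q0A]] := boolP (SB \subset SA); last first.
      have [SA' [T' [sA' [lt st']]]] := grow_tree_A st q0B q0A.
      apply: IH st'; apply: leq_trans le_n _.
      by rewrite addSnnS leq_add2l -addSn leq_add2r proper_card.
    have e : SA = SB by apply/eqP; rewrite finset.eqEsubset sAB.
    by exists SB, T, sA, sB; rewrite -{1}e.
  have full (S S' : {set Q}) : (#|{: Q}| + #|{: Q}| <= #|S| + #|S'|)%N -> S = finset.setT.
    move=> le; apply/eqP; rewrite eqEcard finset.subsetT cardsT.
    by rewrite -(leq_add2r #|S'|) (leq_trans _ le) // leq_add2l max_card.
  exists finset.setT, T, sA, sB; rewrite add0n in le_n.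
  by rewrite -{1}(full _ _ le_n) -(full SB SA) // addnC.
by apply: (grow (#|{: Q}| + #|{: Q}|)%N) st0; apply: leq_addr.
Qed.

Lemma spanning_tree_full S T sA sB q g : tree_state S S T sA sB ->
  q \in S -> q * psi g \in S.
Proof.
move=> [[cA _ _] [cB _ _] _ _ _]; move: g q.
suff SP g : forall q, q \in S <-> q * psi g \in S by move=> g q /(SP g).
pose D : set X := [set g | forall q, q \in S <-> q * psi g \in S].
apply: (X_gen (S := D)) => [|x q|y q]; first split=> [q|g1 g2 D1 D2 q].
- by rewrite gmulf1 mulg1.
- rewrite (D2 (q * psi (g1 * g2^-1))) -mulgA -gmulfM mulgVK; exact: D1.
- split=> [|/(cA _ x^-1)]; first exact: cA.
  by rewrite !gmulfV mulgK.
split=> [|/(cB _ y^-1)]; first exact: cB.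
by rewrite !gmulfV mulgK.
Qed.

(* The kernel of [psi] is free on the edges outside the spanning tree. *)
Lemma kernel_free : exists (L : groupType) (f : hom L X),
  [/\ free_group L, injective f & range f = kernel psi].
Proof.
have [L [f [f_inj fE]]] := exists_subgroup_hom (kernel_normal psi).1.
exists L, f; split=> //.
have [S [T [sA [sB st]]]] := exists_spanning_tree.
have [hA hB [S1 sA1] Tc [TS Tr]] := st; have [cA pA mA] := hA; have [cB pB mB] := hB.
have [rho [rhoP rhoM]] := coset_repr (range_subgroup (psi \o (a \o i))).
have rhoMi q h : rho (q * psi (a (i h))) = rho q by apply: rhoM; exists h.
have rhoE q : exists h, rho q = q * psi (a (i h)).
  by have [h _ /= hE] := rhoP q; exists h; rewrite hE mulVKg.
have rhoK q : rho (rho q) = rho q by have [h {1}->] := rhoE q; rewrite rhoMi.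
have rhoS q : q \in S -> rho q \in S by have [h ->] := rhoE q; apply: cA.
have rhoT q : (rho q \in T) = (q \in T).
  have [h ->] := rhoE q; apply/idP/idP; last exact: Tc.
  by move=> /Tc-/(_ h^-1); rewrite !gmulfV mulgK.
(* The condition [rho q = q] selects one representative of each coset of psi(H), so each edge is
   counted once. *)
pose edge q := [/\ q \in S, q \notin T & rho q = q].
pose I := {q : Q | edge q}.
(* The loop of the edge q: through the tree to one end, across the edge, and back through the
   tree. *)
pose el q := sA q / sB q.
have el_rho q : q \in S -> el (rho q) = el q.
  move=> qS; have [h ->] := rhoE q; rewrite /el -mA // abH -mB // -abH.
  by rewrite invgM mulgA mulgK.
have /choice[e eE] q : exists l, q \in S -> f l = el q.
  have [qS|nq] := boolP (q \in S); last by exists 1.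
  have : kernel psi (el q) by rewrite /kernel /= gmulfF pA // pB // mulgV.
  by rewrite -fE => -[l _ lE]; exists l.
exists I, (fun x => e (sval x)) => K f0.
(* Existence: r is [f0] on the edges of the basis and 1 on all others. On the kernel of [psi] the
   coordinate at 1 of the twisted homomorphism is multiplicative, and its value at the loop of q is
   r(q). *)
pose r q := if pselect (edge (rho q)) is left qE' then f0 (exist _ _ qE') else 1.
have rC : half_invariant r by move=> q h; rewrite /r rhoMi.
have [phi tw] := X_twist rC; have [_ _ phi2] := tw.
have [rA rB] : (forall q, q \in S -> (phi (sA q)).1 1 = 1) /\
    (forall q, q \in S -> (phi (sB q)).1 1 = (r q)^-1).
  apply: Tr rC tw _ => q qT; rewrite /r; case: pselect => // hq.
  by have [_ nT _] := hq; rewrite rhoT qT in nT.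
have psif l : psi (f l) = 1.
  by have : range f (f l); [exists l | rewrite fE].
have gM : {morph (fun l => (phi (f l)).1 1) : x y / x * y}.
  by move=> x y; rewrite gmulfM (twists_mul _ _ tw) psif.
have g_e (x : I) : (phi (f (e (sval x)))).1 1 = f0 x.
  case: x => q /= qE; have [qS _ rq] := qE; rewrite eE // /el (twists_mul _ _ tw).
  rewrite rA // pA // mul1g gmulfV wreath_invE1 phi2 pB // mulgV rB // invgK.
  rewrite /r; case: pselect => [qE'|]; last by rewrite rq.
  by congr f0; apply: eq_exist.
have [g0 g0E] : exists g0 : hom L K, forall l, g0 l = (phi (f l)).1 1.
  by exists (hom_of_morph gM).
exists g0; split=> [x|g' g'E]; first by rewrite g0E.
pose E : set L := [set l | g' l = g0 l].
have sE : subgroup E.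
  split=> [|x y]; rewrite /E /= ?gmulf1 // => Ex Ey.
  by rewrite !gmulfF Ex Ey.
have E_el q : q \in S -> exists2 l, E l & f l = el q.
  move=> qS; have [qT|qT] := boolP (q \in T).
    exists 1; first exact: subgroup1.
    by have [_ _ e0] := TS q qT; rewrite gmulf1 /el e0 mulgV.
  have qI : edge (rho q) by split; [apply: rhoS | rewrite rhoT | apply: rhoK].
  exists (e (rho q)); last by rewrite eE ?rhoS // el_rho.
  by have := g'E (exist _ _ qI); rewrite /E /= g0E (g_e (exist _ _ qI)).
(* Uniqueness by Schreier rewriting: moving g past [sA q] leaves a product of loops. A generator
   from A leaves nothing, and b(y) leaves the loop of q divided by the loop of the new point. *)
pose D : set X := [set g | forall q, q \in S ->
  exists2 l, E l & sA q * g = f l * sA (q * psi g)].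
have Dall g : D g.
  apply: (X_gen (S := D)) => [|x q qS|y q qS]; first split=> [q qS|g1 g2 D1 D2 q qS].
  - exists 1; first exact: subgroup1.
    by rewrite !gmulf1 !mulg1 mul1g.
  - have q'S : q * psi (g1 / g2) \in S by apply: (spanning_tree_full _ st).
    have [l1 E1 e1] := D1 q qS; have [l2 E2 e2] := D2 _ q'S.
    exists (l1 / l2); first exact: sE.2.
    rewrite mulgA e1 gmulfF -mulgA -mulgA; congr (_ * _).
    have e3 : q * psi (g1 / g2) * psi g2 = q * psi g1 by rewrite -mulgA -gmulfM mulgVK.
    by apply: (mulgI (f l2)); rewrite mulVKg mulgA -e3 -e2 mulgK.
  - exists 1; first exact: subgroup1.
    by rewrite gmulf1 mul1g mA.
  have [l1 E1 e1] := E_el q qS; have [l2 E2 e2] := E_el _ (cB q y qS).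
  exists (l1 / l2); first exact: sE.2.
  by rewrite gmulfF e1 e2 /el -mB // !invgM !invgK !mulgA mulgVK mulgVK.
move=> l; have [l' El' lE] := Dall (f l) 1 S1.
move: lE; rewrite psif mulg1 sA1 mul1g mulg1 => /f_inj->; exact: El'.
Qed.

End FreeKernel.

Lemma factor_hom (G X Y : groupType) (pi : hom G X) (f : hom G Y) :
    surjective pi -> (forall g, pi g = 1 -> f g = 1) ->
  exists f' : hom X Y, forall g, f' (pi g) = f g.
Proof.
move=> ps kf; have /choice[t tE] x : exists g, pi g = x.
  by have [g _ gE] : range pi x by [rewrite ps]; exists g.
have eqf g g' : pi g = pi g' -> f g = f g'.
  by move=> e; apply/divg1_eq; rewrite -gmulfF; apply: kf; rewrite gmulfF e mulgV.
have fM : {morph (fun x => f (t x)) : x y / x * y}.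
  by move=> x y; rewrite -gmulfM; apply: eqf; rewrite gmulfM !tE.
by exists (hom_of_morph fM) => g; apply: eqf; rewrite tE.
Qed.

Lemma free_extension (P : nat_pred) (A B H G : groupType)
    (i : hom H A) (j : hom H B) (a : hom A G) (b : hom B G) (Q R : finGroupType)
    (psiA : hom A Q) (psiB : hom B Q) (r : Q -> R) g :
    generalized_free_product i j a b -> nilpotent_fin P Q ->
    (forall h, psiA (i h) = psiB (j h)) -> coset_function i psiA r ->
    (forall phi, twisted_hom a b psiA psiB r phi -> phi g <> 1) ->
  exists (X : groupType) (s : hom G X),
    [/\ extension_class free_group (finite_nilpotent_P_group P) X, surjective s &
        s g <> 1].
Proof.
move=> hG QP psiH rC gr; have [_ _ abH _] := hG.
have [psi [psia psib]] := exists_amalgam_hom hG psiH.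
pose ker : set G := [set g | forall (K : groupType) (r : Q -> K) phi,
  coset_function i psiA r -> twisted_hom a b psiA psiB r phi -> phi g = 1].
have nker : normal ker.
  split; first split=> [K r0 phi _ _|x y kx ky K r0 phi r0C tw]; first by rewrite gmulf1.
    by rewrite gmulfF (kx K r0) // (ky K r0) // mulgV.
  by move=> x y kx K r0 phi r0C tw; rewrite gmulfJ (kx K r0) // conj1g.
have tw2 (K : groupType) (r0 : Q -> K) phi : twisted_hom a b psiA psiB r0 phi ->
    forall g, (phi g).2 = psi g.
  move=> [pa pb]; apply: (amalgam_ind hG (S := [set g | (phi g).2 = psi g])).
  - split=> [|x y]; rewrite /= ?gmulf1 // => ex ey.
    by rewrite !gmulfF wreath_mulE2 wreath_invE2 ex ey.
  - by move=> x; rewrite /= pa psia.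
  by move=> y; rewrite /= pb psib.
have [X [pi [ps kpi]]] := exists_quotient_hom nker.
(* [psi] is the top component of any twisted homomorphism, and the given r supplies one; hence it
   factors through X. *)
have [|psi' psi'E] := factor_hom (f := psi) ps.
  move=> x /kpi kx; have [phi tw] := exists_twisted_hom hG psiH rC.
  by rewrite -(tw2 _ _ _ tw) (kx _ _ _ rC tw).
have twist (K : groupType) (r0 : Q -> K) phi : coset_function i psiA r0 ->
    twisted_hom a b psiA psiB r0 phi ->
    exists2 phi', twists (pi \o a) (pi \o b) psi' r0 phi' & forall g, phi' (pi g) = phi g.
  move=> r0C tw; have [|phi' phi'E] := factor_hom (f := phi) ps.
    by move=> x /kpi kx; apply: kx r0C tw.
  exists phi' => //; case: (tw) => pa pb; split=> [x q|y q|x].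
  - by rewrite /= phi'E pa /= ffunE.
  - by rewrite /= phi'E pb /= ffunE psi'E psib.
  have [y _ <-] : range pi x by rewrite ps.
  by rewrite phi'E psi'E (tw2 _ _ _ tw).
have inv (K : Type) (r0 : Q -> K) :
    half_invariant i (pi \o a) psi' r0 -> coset_function i psiA r0.
  by move=> r0C q h; have := r0C q h; rewrite /= psi'E psia.
have [||||L [f [freeL f_inj fE]]] :=
  @kernel_free A B H X Q i j (pi \o a) (pi \o b) psi'.
- by move=> h /=; rewrite abH.
- move=> S sS Sa Sb x; have [y _ <-] : range pi x by rewrite ps.
  apply: (amalgam_ind hG (S := pi @^-1` S)) => //.
  split; rewrite /preimage /= ?gmulf1; first exact: subgroup1.
  by move=> u v Su Sv; rewrite gmulfF; apply: sS.2.
- move=> K r0 /inv r0C; have [phi tw] := exists_twisted_hom hG psiH r0C.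
  by have [phi' tw' _] := twist _ _ _ r0C tw; exists phi'.
- move=> x xk; have [y _ yx] : range pi x by rewrite ps.
  rewrite -yx; apply/kpi => K r0 phi r0C tw.
  have [phi' tw' phi'E] := twist _ _ _ r0C tw.
  rewrite -phi'E yx; apply: (xk K r0 phi' _ tw').
  by move=> q h /=; rewrite psi'E psia.
have [D [h [hs hE]]] := hom_image psi'.
exists X, pi; split=> //.
  exists L, (subg_of D), f, h; split=> //.
    by apply: nilpotent_fin_group; apply: nilpotent_fin_subg.
  rewrite fE; apply/seteqP; split=> x; rewrite /kernel /=.
    by move=> px; apply: val_inj; rewrite /= hE.
  by move=> hx; rewrite -hE hx.
move=> /kpi kg; have [phi tw] := exists_twisted_hom hG psiH rC.
by apply: (gr phi tw); apply: kg rC tw.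
Qed.

(** * Residual properties of G *)

Lemma p_nat_prod (p : nat) (Q R : finGroupType) :
  p.-nat #|{: Q}| -> p.-nat #|{: R}| -> p.-nat #|{: (Q * R)%type}|.
Proof. by move=> pQ pR; rewrite card_prod pnatM pQ pR. Qed.

Theorem theorem1 (P : nat_pred) (A B H G : groupType)
    (i : hom H A) (j : hom H B) (a : hom A G) (b : hom B G) :
  {subset P <= prime} ->
  generalized_free_product i j a b ->
  condition_star P i j ->
  [\/ locally_cyclic H,
      range i `<=` center A \/ range j `<=` center B |
      retract (range i) \/ retract (range j)] ->
  ((exists2 q : nat, q \in P &
      separable (finite_P_group q) (range i) /\
      separable (finite_P_group q) (range j)) ->
    residually (finite_nilpotent_P_group P) G) /\
  (separable (finite_nilpotent_P_group P) (range i) ->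
   separable (finite_nilpotent_P_group P) (range j) ->
    [/\ residually (extension_class free_group (finite_nilpotent_P_group P)) G,
        forall p : nat, prime p ->
          residually (extension_class (finite_P_group p)
                                      (finite_nilpotent_P_group P)) G &
        residually (finite_metanilpotent_P_group P) G]).
Proof.
move=> P_prime hG [_ [p0 p0P] [resA resB] [bA bB]] HC.
have [i_inj j_inj abH _] := hG.
have sepP (p : nat) (QA QB : finGroupType) (al0 : hom A QA) (be0 : hom B QB) :
    p \in P -> p.-nat #|{: QA}| -> p.-nat #|{: QB}| ->
    separates_p i j p (kernel al0) (kernel be0).
  move=> pP pA pB; have p_pr : prime p := P_prime p pP.
  apply: separates_kernels => //; exact: (bounded_p_topology_induced p_pr pP).
have sepP' (p : nat) (QB QA : finGroupType) (be0 : hom B QB) (al0 : hom A QA) :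
    p \in P -> p.-nat #|{: QB}| -> p.-nat #|{: QA}| ->
    separates_p j i p (kernel be0) (kernel al0).
  by move=> pP pB pA; apply/separates_swap/sepP.
(* Elements of H have no letters outside H and escape the word argument; they are detected by the
   nilpotent quotients of A. *)
have onH h : a (i h) <> 1 -> exists (Q : finGroupType) (psiA : hom A Q) (psiB : hom B Q),
    [/\ nilpotent_fin P Q, forall h, psiA (i h) = psiB (j h) & psiA (i h) <> 1].
  move=> ah; apply: (residually_nilpotent_on_H P_prime sepP p0P resA i_inj).
  by move=> h1; apply: ah; rewrite h1 !gmulf1.
split=> [[q qP [sepA sepB]] g g1|sepA sepB].
  have q_pr : prime q := P_prime q qP.
  have [[h gE]|[s [w [rw w0 gE]]]] := reduced_form hG g.
    rewrite gE in g1; have [Q [psiA [psiB [QP psiH ph]]]] := onH h g1.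
    have [psi [psia _]] := exists_amalgam_hom hG psiH.
    by apply: (residual_image (f := psi)) QP _; rewrite gE psia.
  have [Q [psiA [psiB [pQ psiH wQ]]]] := exists_coset_separating
    (@p_nat_prod q) (trivial_p_nat q)
    (residually_p_coset_separating sepP qP sepA)
    (residually_p_coset_separating sepP' qP sepB) rw.
  have [R [r [pR rC rw1]]] := word_survives a b psiH q_pr w0 wQ.
  have [phi tw] := exists_twisted_hom hG psiH rC.
  apply: (residual_image (f := phi)); last by rewrite gE; apply: rw1.
  by apply: (nilpotent_fin_p qP); rewrite card_wreath pnatM pnatX pR pQ.
(* Q and the pair of homomorphisms are fixed before p, which is then free to be any prime. *)
have key g : g <> 1 -> exists (Q : finGroupType) (psiA : hom A Q) (psiB : hom B Q),
    [/\ nilpotent_fin P Q, forall h, psiA (i h) = psiB (j h) &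
     forall p, prime p -> exists (R : finGroupType) (r : Q -> R),
      [/\ p.-nat #|{: R}|, coset_function i psiA r &
       forall phi, twisted_hom a b psiA psiB r phi -> phi g <> 1]].
  move=> g1; have [[h gE]|[s [w [rw w0 gE]]]] := reduced_form hG g.
    rewrite gE in g1 *; have [Q [psiA [psiB [QP psiH ph]]]] := onH h g1.
    exists Q, psiA, psiB; split=> // p p_pr; exists 'I_1, (fun=> 1).
    split=> //; first exact: trivial_p_nat.
    by move=> phi [pa _]; rewrite pa => /(congr1 (fun u => u.2)).
  have triv : nilpotent_fin P 'I_1 by apply: (nilpotent_fin_p p0P); apply: trivial_p_nat.
  have [Q [psiA [psiB [QP psiH wQ]]]] := exists_coset_separating
    (@nilpotent_fin_prod P) triv
    (residually_nilpotent_coset_separating P_prime sepP p0P sepA)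
    (residually_nilpotent_coset_separating P_prime sepP' p0P sepB) rw.
  exists Q, psiA, psiB; split=> // p p_pr.
  by have [R [r [pR rC rw1]]] := word_survives a b psiH p_pr w0 wQ; exists R, r; rewrite gE.
have ext (p : nat) g : prime p -> g <> 1 ->
    exists (X : finGroupType) (s : hom G X) (N Q : finGroupType) (f : hom N X) (h : hom X Q),
    [/\ surjective s, s g <> 1, p.-nat #|{: N}|, nilpotent_fin P Q &
     [/\ injective f, surjective h, range f = kernel h &
         (p \in P -> P.-nat #|{: X}|)]].
  move=> p_pr g1; have [Q [psiA [psiB [QP psiH gR]]]] := key g g1.
  have [R [r [pR rC rg]]] := gR p p_pr.
  have [phi tw] := exists_twisted_hom hG psiH rC.
  exact: (wreath_image_extension p_pr pR QP (rg phi tw)).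
split=> [g g1|p p_pr g g1|g g1].
- have [Q [psiA [psiB [QP psiH gR]]]] := key g g1.
  (* All that counts is one function r that keeps g alive; the prime 2 is an arbitrary choice. *)
  have [R [r [_ rC rg]]] := gR 2 isT.
  exact: free_extension hG QP psiH rC rg.
- have [X [s [N [Q [f [h [ss sg pN QP [f_inj hs fh _]]]]]]]] := ext p g p_pr g1.
  exists X, s; split=> //; exists N, Q, f, h; split=> //.
    exact: finite_P_group_fin.
  exact: nilpotent_fin_group.
(* With the prime p0 in P, the base is a P-group too, and so is the whole image. *)
have [X [s [N [Q [f [h [ss sg pN QP [f_inj hs fh PX]]]]]]]] := ext p0 g (P_prime _ p0P) g1.
exists X, s; split=> //; split; first by apply: finite_P_group_fin; apply: PX.
exists N, Q, f, h; split=> //; last by have [] := nilpotent_fin_group QP.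
by have [_] := nilpotent_fin_group (nilpotent_fin_p p0P pN).
Qed.
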